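(* Let the standing assumptions of the context hold with $C=\mathbb R^n$ (i.e. $h$ has full domain), let $(\gamma,\beta,c,\xi)$ be admissible, let $x^{-1},x^0\in\mathbb R^n$ and let $(x^k)_{k\in\mathbb N}$ satisfy $x^{k+1}\in T_{\gamma,\beta}(x^k,x^{k-1})$ for all $k\ge0$ (a sequence generated by the $i^*$FRB algorithm). For $k\in\mathbb N$ let $z^k=(x^{k+1},x^k,x^{k-1})$ and let $\omega(z^0)$ be the set of limit points of $(z^k)_{k\in\mathbb N}$. Define, for $w,x,x^-\in\mathbb R^n$, $$\mathcal F(w,x,x^-)=\mathcal M_{\gamma,\beta}(w;x,x^-)+\tfrac{c}{2\gamma}D_h(x,x^-)+D_\xi(x,x^-).$$ Assume in addition: (a) $\varphi$ is level bounded; (b) $f,h$ are twice continuously differentiable and $\nabla^2h$ is positive definite; (c) there exist $r>0$ and $\eta\in(0,\infty]$ such that $\mathcal F$ satisfies the (setwise) generalized concave Kurdyka–Łojasiewicz property on $\Omega=\omega(z^0)$ with respect to $U=\Omega_r$ and $\eta$. Then $\sum_{k=0}^\infty\|x^{k+1}-x^k\|<\infty$ and there exists $x^\star$ with $0\in\hat\partial\varphi(x^\star)$ such that $x^k\to x^\star$ as $k\to\infty$. To be specific, there exists $k_0\in\mathbb N$ such that for all $l\ge k_0+1$ $$\sum_{k=0}^\infty\|x^{k+1}-x^k\|\le\sum_{k=0}^{l}\|x^{k+1}-x^k\|+\frac{4\gamma M}{c\sigma}\,\tilde\psi\bigl(\mathcal L_{\gamma,\beta}(x^l,x^{l-1})-\varphi^\star\bigr),$$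 where $M>0$ is some constant (independent of $l$), $\sigma>0$ is the strong convexity modulus of $h$ on a closed ball $\mathcal B$ in which $(x^k)$ lies, and $\tilde\psi$ is the exact modulus of the generalized concave Kurdyka–Łojasiewicz property of $\mathcal F$ on $\Omega$ with respect to $U$ and $\eta$.
   Context: Conventions: $\overline{\mathbb R}=\mathbb R\cup\{\pm\infty\}$, $\infty-\infty=\infty$, $1/0=\infty$; $\operatorname{dom}F=\{F<\infty\}$; $\operatorname{argmin}F=\{w: F(w)\le F(z)\ \forall z\}$. Level bounded: all sublevel sets bounded. 1-coercive: $F(x)/\|x\|\to\infty$ as $\|x\|\to\infty$. $\hat\partial$ and $\partial$ denote the regular (Fréchet) and limiting (Mordukhovich) subdifferentials; $\operatorname{dist}(0,\emptyset)=\infty$. ''Limit point'' means cluster point. Kernel. $C\subseteq\mathbb R^n$ is a nonempty open convex set with closure $\overline C$, and $h:\mathbb R^n\to\overline{\mathbb R}$ is a Legendre kernel: proper, lsc, strictly convex, 1-coercive, differentiable on $C$, with $\operatorname{dom}\nabla h=\operatorname{int}\operatorname{dom}h=C$, and essentially smooth ($\|\nabla h(x_k)\|\to\infty$ for every sequence in $C$ converging to a boundary point of $C$). For $\psi$ differentiable on $C$ (not necessarily convex) and $y\in C$, $D_\psi(x,y):=\psi(x)-\psi(y)-\langle\nabla\psi(y),x-y\rangle$. Problem and standing assumptions. $\varphi:=f+g$ and $\varphi_{\overline C}:=\varphi+\delta_{\overline C}$ ($\delta$ the indicator function). (1) $f:\mathbb R^n\to\overline{\mathbb R}$ is proper, lsc,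 differentiable on $\operatorname{int}\operatorname{dom}f\ne\emptyset$, and smooth relative to $h$: $\operatorname{dom}f\supseteq\operatorname{dom}h$ and $Lh\pm f$ are convex on $C$ for some $L\ge0$. (2) $g:\mathbb R^n\to\overline{\mathbb R}$ is proper and lsc. (3) $\inf\varphi_{\overline C}>-\infty$. (4) For all $v\in\mathbb R^n$, $\gamma>0$: $\operatorname{argmin}\{\gamma g+h-\langle v,\cdot\rangle\}\subseteq C$. Constants. Fix $\sigma_{f,h},\sigma_{-f,h}\in\mathbb R$ such that $f-\sigma_{f,h}h$ and $-f-\sigma_{-f,h}h$ are convex on $C$. $L_{f,h}:=\max\{|\sigma_{f,h}|,|\sigma_{-f,h}|\}$, assumed positive ($f$ not affine); $p_{\pm f,h}:=\sigma_{\pm f,h}/L_{f,h}$; $\alpha:=\gamma L_{f,h}$ for a stepsize $\gamma>0$. Model, operator, envelope. For $\gamma>0$, $\beta\in\mathbb R$ let $\hat h:=\frac1\gamma h-f$, $\hat f_\beta:=f-\frac\beta\gamma h$, and for $w\in\mathbb R^n$, $x,x^-\in C$, $$\mathcal M_{\gamma,\beta}(w;x,x^-):=\varphi(w)+D_{\hat h}(w,x)+\langle w-x,\nabla\hat f_\beta(x)-\nabla\hat f_\beta(x^-)\rangle,$$ $T_{\gamma,\beta}(x,x^-):=\operatorname{argmin}_w\mathcal M_{\gamma,\beta}(w;x,x^-)$, $\Phi_{\gamma,\beta}(x,x^-):=\inf_w\mathcal M_{\gamma,\beta}(w;x,x^-)$. The step $x^{k+1}\in T_{\gamma,\beta}(x^k,x^{k-1})$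 is equivalent to: let $y^k$ satisfy $\nabla h(y^k)=\nabla h(x^k)-\gamma(\nabla f(x^k)-\nabla f(x^{k-1}))$ and choose $x^{k+1}\in\operatorname{argmin}_w\{g(w)+\langle w,\nabla f(x^k)-\frac\beta\gamma(\nabla h(x^k)-\nabla h(x^{k-1}))\rangle+\frac1\gamma D_h(w,y^k)\}$. Admissible parameters. $(\gamma,\beta,c,\xi)$ with $\gamma>0$, $\beta\in\mathbb R$ is admissible if either (A) $\hat f_\beta$ is convex on $C$ (i.e. $\alpha p_{f,h}-\beta\ge0$), $\beta>-\frac{1+3\alpha p_{-f,h}}2$, $\xi=\hat f_\beta$ and $c=1+2\beta+3\alpha p_{-f,h}>0$; or (B) $\nabla\hat f_\beta$ is $L_{\hat f_\beta}$-Lipschitz on $C$, $h$ is $\sigma_h$-strongly convex ($\sigma_h>0$), $\xi=\frac{L_{\hat f_\beta}}2\|\cdot\|^2$ and $c=(1+\alpha p_{-f,h})\sigma_h-2\gamma L_{\hat f_\beta}>0$. In either case $\mathcal L_{\gamma,\beta}(x,x^-):=\Phi_{\gamma,\beta}(x,x^-)+\frac c{2\gamma}D_h(x,x^-)+D_\xi(x,x^-)$ on $C\times C$. The number $\varphi^\star$ is $\varphi^\star:=\lim_k\mathcal L_{\gamma,\beta}(x^k,x^{k-1})$ (the paper establishes that this limit exists under admissibility and that, under the assumptions of the theorem, $\mathcal F$ is constantly equal to $\varphi^\star$ on $\omega(z^0)$). Generalized concave KL property. For $\eta\in(0,\infty]$, $\Psi_\eta$ is the class of functions $\psi:[0,\eta)\to\mathbb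 R_+$ that are right-continuous at $0$ with $\psi(0)=0$ and strictly increasing on $[0,\eta)$. Let $F:\mathbb R^m\to\overline{\mathbb R}$ be proper lsc, $V\subseteq\operatorname{dom}\partial F$ nonempty with $F\equiv\mu$ on $V$. $F$ has the setwise generalized concave KL property on $V$ with respect to $U\supset V$ and $\eta$ if there is a concave $\psi\in\Psi_\eta$ (a concave desingularizing function) such that for every $x\in U$ with $0<F(x)-\mu<\eta$: $\psi'_-(F(x)-\mu)\cdot\operatorname{dist}(0,\partial F(x))\ge1$, with $\psi'_-$ the left derivative. $\Omega_r:=\{z:\operatorname{dist}(z,\Omega)<r\}$. The exact modulus of the property on $\Omega$ with respect to $U$ and $\eta$ is $\tilde\psi:[0,\eta)\to\mathbb R_+$, $\tilde\psi(0)=0$, $\tilde\psi(t)=\int_0^t\rho(s)\,ds$ for $0<t<\eta$, where $\rho(s)=\sup\{1/\operatorname{dist}(0,\partial F(x)): x\in U,\ s\le F(x)-\mu<\eta\}$. *)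

(* Defs.v *)
From HB Require Import structures.
From mathcomp Require Import all_boot all_order all_algebra.
From mathcomp Require Import all_classical all_reals all_analysis.

Set Implicit Arguments.
Unset Strict Implicit.
Unset Printing Implicit Defensive.

Import Order.TTheory GRing.Theory Num.Theory.
Import numFieldNormedType.Exports.

Local Open Scope classical_set_scope.
Local Open Scope ring_scope.

(* Euclidean structure on R^n. The library norm `|x| on 'rV[R]_n is the sup
   norm; it is only used below through the topology and boundedness, which
   agree with the Euclidean ones. *)

Definition dot {R : realType} {n : nat} (u v : 'rV[R]_n) : R :=
  \sum_(i < n) u ord0 i * v ord0 i.

Definition enorm {R : realType} {n : nat} (u : 'rV[R]_n) : R :=
  Num.sqrt (dot u u).

Definition eball {R : realType} {n : nat} (a : 'rV[R]_n) (rho : R) :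
    set 'rV[R]_n :=
  [set y | enorm (y - a) <= rho].

(* The infimum over the empty set is +oo. *)
Definition setdist {R : realType} {n : nat} (z : 'rV[R]_n) (S : set 'rV[R]_n) :
    \bar R :=
  ereal_inf [set (enorm (z - w))%:E | w in S].

Definition enlargement {R : realType} {n : nat} (S : set 'rV[R]_n) (r : R) :
    set 'rV[R]_n :=
  [set z | (setdist z S < r%:E)%E].

(* Extended-real-valued functions. The real-valued function underlying
   F : 'rV[R]_n -> \bar R on its domain is fine \o F. *)

Definition edom {R : realType} {n : nat} (F : 'rV[R]_n -> \bar R) :
    set 'rV[R]_n :=
  [set w | (F w < +oo)%E].

Definition proper_fun {R : realType} {n : nat} (F : 'rV[R]_n -> \bar R) : Prop :=
  (forall w, (-oo < F w)%E) /\ edom F !=set0.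

Definition argmin {R : realType} {n : nat} (F : 'rV[R]_n -> \bar R) :
    set 'rV[R]_n :=
  [set w | forall z, (F w <= F z)%E].

Definition indicator {R : realType} {n : nat} (A : set 'rV[R]_n)
    (w : 'rV[R]_n) : \bar R :=
  if w \in A then 0%E else +oo%E.

Definition level_bounded {R : realType} {n : nat} (F : 'rV[R]_n -> \bar R) :
    Prop :=
  forall a : R, bounded_set [set w | (F w <= a%:E)%E].

Definition strictly_convex {R : realType} {n : nat}
    (F : 'rV[R]_n -> \bar R) : Prop :=
  forall (x y : 'rV[R]_n) (t : R), edom F x -> edom F y -> x != y ->
    0 < t < 1 ->
    (F (t *: x + (1 - t) *: y)%R < t%:E * F x + (1 - t)%:E * F y)%E.

Definition coercive1 {R : realType} {n : nat} (F : 'rV[R]_n -> \bar R) :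
    Prop :=
  forall A : R, exists rho : R, forall x : 'rV[R]_n,
    rho < enorm x -> (A%:E <= F x * ((enorm x)^-1)%:E)%E.

Definition strongly_convex_on {R : realType} {n : nat} (S : set 'rV[R]_n)
    (sigma : R) (F : 'rV[R]_n -> \bar R) : Prop :=
  convex_function S (fun x => fine (F x) - sigma / 2 * enorm x ^+ 2).

Definition grad {R : realType} {n : nat} (psi : 'rV[R]_n -> R)
    (x : 'rV[R]_n) : 'rV[R]_n :=
  \row_(i < n) 'D_(delta_mx ord0 i) (psi : 'rV[R]_n -> R^o) x.

Definition hessian {R : realType} {n : nat} (psi : 'rV[R]_n -> R)
    (x : 'rV[R]_n) : 'M[R]_n :=
  'J (grad psi) x.

Definition differentiable_at {R : realType} {n : nat}
    (F : 'rV[R]_n -> \bar R) (x : 'rV[R]_n) : Prop :=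
  interior (edom F) x /\ differentiable (fine \o F : 'rV[R]_n -> R^o) x.

Definition C2 {R : realType} {n : nat} (F : 'rV[R]_n -> \bar R) : Prop :=
  [/\ forall x, differentiable_at F x,
      forall x, differentiable (grad (fine \o F)) x
    & continuous (hessian (fine \o F))].

Definition posdef {R : realType} {n : nat} (A : 'M[R]_n) : Prop :=
  forall u : 'rV[R]_n, u != 0 -> 0 < dot (u *m A) u.

(* The gradient is that of fine \o F; meaningful when F is finite near y. *)
Definition bregman {R : realType} {n : nat} (F : 'rV[R]_n -> \bar R)
    (x y : 'rV[R]_n) : \bar R :=
  (F x - F y - (dot (grad (fine \o F) y) (x - y))%:E)%E.

(* Frechet subdifferential: F y >= F x + <v, y - x> + o(|y - x|). *)
Definition regular_subdiff {R : realType} {n : nat} (F : 'rV[R]_n -> \bar R)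
    (x : 'rV[R]_n) : set 'rV[R]_n :=
  [set v | F x \is a fin_num /\
    forall e : R, 0 < e -> \forall y \near x,
      (F x + (dot v (y - x) - e * enorm (y - x))%:E <= F y)%E].

(* Mordukhovich subdifferential. *)
Definition limiting_subdiff {R : realType} {n : nat} (F : 'rV[R]_n -> \bar R)
    (x : 'rV[R]_n) : set 'rV[R]_n :=
  [set v | F x \is a fin_num /\
    exists xs vs : nat -> 'rV[R]_n,
      [/\ xs k @[k --> \oo] --> x,
          F (xs k) @[k --> \oo] --> F x,
          forall k, regular_subdiff F (xs k) (vs k)
        & vs k @[k --> \oo] --> v]].

Record legendre_kernel {R : realType} {n : nat} (C : set 'rV[R]_n)
    (h : 'rV[R]_n -> \bar R) : Prop := LegendreKernel {
  kernel_domain_nonempty : C !=set0;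
  kernel_domain_open : open C;
  kernel_domain_convex : convex_set C;
  kernel_proper : proper_fun h;
  kernel_lsc : lower_semicontinuous h;
  kernel_strictly_convex : strictly_convex h;
  kernel_coercive : coercive1 h;
  kernel_interior : interior (edom h) = C;
  kernel_dom_grad : [set x | differentiable_at h x] = C;
  kernel_essentially_smooth :
    forall (u : nat -> 'rV[R]_n) (b : 'rV[R]_n),
      (forall k, C (u k)) -> u k @[k --> \oo] --> b ->
      closure C b -> ~ C b ->
      enorm (grad (fine \o h) (u k)) @[k --> \oo] --> +oo
}.

Definition cost {R : realType} {n : nat} (f g : 'rV[R]_n -> \bar R)
    (w : 'rV[R]_n) : \bar R :=
  (f w + g w)%E.

Record standing_assumptions {R : realType} {n : nat} (C : set 'rV[R]_n)
    (h f g : 'rV[R]_n -> \bar R) : Prop := StandingAssumptions {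
  smooth_proper : proper_fun f;
  smooth_lsc : lower_semicontinuous f;
  smooth_interior : interior (edom f) !=set0;
  smooth_differentiable :
    forall x, interior (edom f) x -> differentiable_at f x;
  smooth_dom : edom h `<=` edom f;
  smooth_relative :
    exists L : R, [/\ 0 <= L,
      convex_function C (fun x => L * fine (h x) + fine (f x))
    & convex_function C (fun x => L * fine (h x) - fine (f x))];
  nonsmooth_proper : proper_fun g;
  nonsmooth_lsc : lower_semicontinuous g;
  cost_bounded_below :
    (-oo < ereal_inf
             (range (fun w => cost f g w + indicator (closure C) w)))%E;
  prox_range :
    forall (v : 'rV[R]_n) (gamma : R), 0 < gamma ->
      argmin (fun w => gamma%:E * g w + h w - (dot v w)%:E)%E `<=` C
}.

(* sigf and sigmf stand for sigma_{f,h} and sigma_{-f,h}. *)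

Definition Lfh {R : realType} (sigf sigmf : R) : R :=
  Num.max `|sigf| `|sigmf|.

Record relative_constants {R : realType} {n : nat} (C : set 'rV[R]_n)
    (h f : 'rV[R]_n -> \bar R) (sigf sigmf : R) : Prop := RelativeConstants {
  relative_convex :
    convex_function C (fun x => fine (f x) - sigf * fine (h x));
  relative_concave :
    convex_function C (fun x => - fine (f x) - sigmf * fine (h x));
  Lfh_gt0 : 0 < Lfh sigf sigmf
}.

(* In the scope %dE one has +oo - oo = +oo. *)

Definition hhat {R : realType} {n : nat} (h f : 'rV[R]_n -> \bar R)
    (gamma : R) (w : 'rV[R]_n) : \bar R :=
  ((gamma^-1)%:E * h w - f w)%dE.

Definition fhat {R : realType} {n : nat} (h f : 'rV[R]_n -> \bar R)
    (gamma beta : R) (w : 'rV[R]_n) : \bar R :=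
  (f w - (beta / gamma)%:E * h w)%dE.

Definition model {R : realType} {n : nat} (h f g : 'rV[R]_n -> \bar R)
    (gamma beta : R) (w x xm : 'rV[R]_n) : \bar R :=
  let gfhat := grad (fine \o fhat h f gamma beta) in
  (cost f g w + bregman (hhat h f gamma) w x
   + (dot (w - x) (gfhat x - gfhat xm))%:E)%E.

Definition frb_step {R : realType} {n : nat} (h f g : 'rV[R]_n -> \bar R)
    (gamma beta : R) (x xm : 'rV[R]_n) : set 'rV[R]_n :=
  argmin (fun w => model h f g gamma beta w x xm).

Definition envelope {R : realType} {n : nat} (h f g : 'rV[R]_n -> \bar R)
    (gamma beta : R) (x xm : 'rV[R]_n) : \bar R :=
  ereal_inf (range (fun w => model h f g gamma beta w x xm)).

Definition admissible_convex {R : realType} {n : nat} (C : set 'rV[R]_n)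
    (h f : 'rV[R]_n -> \bar R) (sigf sigmf gamma beta c : R)
    (xi : 'rV[R]_n -> \bar R) : Prop :=
  let alpha := gamma * Lfh sigf sigmf in
  let pmf := sigmf / Lfh sigf sigmf in
  [/\ convex_function C (fine \o fhat h f gamma beta),
      - ((1 + 3 * alpha * pmf) / 2) < beta,
      xi = fhat h f gamma beta,
      c = 1 + 2 * beta + 3 * alpha * pmf
    & 0 < c].

Definition admissible_lipschitz {R : realType} {n : nat} (C : set 'rV[R]_n)
    (h f : 'rV[R]_n -> \bar R) (sigf sigmf gamma beta c : R)
    (xi : 'rV[R]_n -> \bar R) : Prop :=
  let alpha := gamma * Lfh sigf sigmf in
  let pmf := sigmf / Lfh sigf sigmf in
  let gfhat := grad (fine \o fhat h f gamma beta) in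
  exists Lfhat sigmah : R,
    [/\ 0 <= Lfhat /\ (forall x y, C x -> C y ->
          enorm (gfhat x - gfhat y) <= Lfhat * enorm (x - y)),
        0 < sigmah /\ strongly_convex_on (edom h) sigmah h,
        xi = (fun x => (Lfhat / 2 * enorm x ^+ 2)%:E),
        c = (1 + alpha * pmf) * sigmah - 2 * gamma * Lfhat
      & 0 < c].

Definition admissible {R : realType} {n : nat} (C : set 'rV[R]_n)
    (h f : 'rV[R]_n -> \bar R) (sigf sigmf gamma beta c : R)
    (xi : 'rV[R]_n -> \bar R) : Prop :=
  0 < gamma /\
  (admissible_convex C h f sigf sigmf gamma beta c xi \/
   admissible_lipschitz C h f sigf sigmf gamma beta c xi).

Definition lyapunov {R : realType} {n : nat} (h f g : 'rV[R]_n -> \bar R)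
    (gamma beta c : R) (xi : 'rV[R]_n -> \bar R) (x xm : 'rV[R]_n) : \bar R :=
  (envelope h f g gamma beta x xm + (c / (2 * gamma))%:E * bregman h x xm
   + bregman xi x xm)%E.

(* A point of R^n x R^n x R^n is the block row vector
   row_mx w (row_mx x xm) : 'rV[R]_(n + (n + n)). *)

Definition triple {R : realType} {n : nat} (w x xm : 'rV[R]_n) :
    'rV[R]_(n + (n + n)) :=
  row_mx w (row_mx x xm).

Definition merit {R : realType} {n : nat} (h f g : 'rV[R]_n -> \bar R)
    (gamma beta c : R) (xi : 'rV[R]_n -> \bar R)
    (z : 'rV[R]_(n + (n + n))) : \bar R :=
  let w := lsubmx z in
  let x := lsubmx (rsubmx z) in
  let xm := rsubmx (rsubmx z) in
  (model h f g gamma beta w x xm + (c / (2 * gamma))%:E * bregman h x xm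
   + bregman xi x xm)%E.

(* For a sequence (x k) started at x^{-1} = xm1, previous xm1 x k is x^{k-1}. *)
Definition previous {T : Type} (xm1 : T) (x : nat -> T) (k : nat) : T :=
  if k is k'.+1 then x k' else xm1.

Definition limit_points {R : realType} {m : nat} (z : nat -> 'rV[R]_m) :
    set 'rV[R]_m :=
  cluster (z k @[k --> \oo]).

Definition co_interval {R : realType} (eta : \bar R) : set R :=
  [set t | 0 <= t /\ (t%:E < eta)%E].

Definition left_derive {R : realType} (psi : R -> R) (t : R) : R :=
  lim (((psi (t + s) - psi t) / s) @[s --> (0 : R)^'-]).

(* Only the values of psi on [0, eta) matter. *)
Record concave_desingularizing {R : realType} (eta : \bar R) (psi : R -> R) :
    Prop := ConcaveDesingularizing {
  desing_ge0 : forall t, co_interval eta t -> 0 <= psi t;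
  desing0 : psi 0 = 0;
  desing_right_continuous : psi t @[t --> (0 : R)^'+] --> psi 0;
  desing_increasing : forall s t, co_interval eta s -> co_interval eta t ->
    s < t -> psi s < psi t;
  desing_concave :
    convex_function (co_interval eta : set R^o) (fun t => - psi t)
}.

(* mu stands for the constant value of F on V. The context in which the
   property is considered (F proper lsc, V nonempty and contained in the
   domain of limiting_subdiff F, F = mu on V) is not part of the property. *)
Definition setwise_KL {R : realType} {m : nat} (F : 'rV[R]_m -> \bar R)
    (V U : set 'rV[R]_m) (mu eta : \bar R) : Prop :=
  V `<=` U /\
  exists psi : R -> R, concave_desingularizing eta psi /\
    forall x, U x -> (0 < F x - mu < eta)%E ->
      (1 <= (left_derive psi (fine (F x - mu)))%:E
            * setdist 0 (limiting_subdiff F x))%E.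

(* The supremum is taken in [0, +oo], hence is 0 over the empty set. Inversion
   in \bar R satisfies 0^-1 = +oo and +oo^-1 = 0. *)
Definition KL_rate {R : realType} {m : nat} (F : 'rV[R]_m -> \bar R)
    (U : set 'rV[R]_m) (mu eta : \bar R) (s : R) : \bar R :=
  ereal_sup ([set 0%E] `|` [set ((setdist 0 (limiting_subdiff F x))^-1)%E
                               | x in [set x | U x /\ (s%:E <= F x - mu < eta)%E]]).

(* The KL property makes the integral finite for 0 < t < eta. *)
Definition exact_modulus {R : realType} {m : nat} (F : 'rV[R]_m -> \bar R)
    (U : set 'rV[R]_m) (mu eta : \bar R) (t : R) : R :=
  fine (\int[lebesgue_measure]_(s in `]0%R, t[) KL_rate F U mu eta s)%E.

(* Main.v *)
Require Import Defs.
From HB Require Import structures.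
From mathcomp Require Import all_boot all_order all_algebra.
From mathcomp Require Import all_classical all_reals all_analysis.
From mathcomp Require Import measurable_realfun.
From mathcomp Require Import ring lra.
Import Order.TTheory GRing.Theory Num.Theory.
Import numFieldNormedType.Exports.
Local Open Scope classical_set_scope.
Local Open Scope ring_scope.

Set Implicit Arguments.
Unset Strict Implicit.
Unset Printing Implicit Defensive.

(** Write D_psi for the Bregman distance of psi, a_k = |x_k - x_{k-1}|, and L_k
   for the Lyapunov value at (x_k, x_{k-1}), with limit mu. The first task is a
   function that decreases along the iteration. The envelope at (x_{k+1}, x_k) is
   at most the model there evaluated at w = x_{k+1}, which is phi(x_{k+1}). With
   the three-point identity (convex parameters) or Cauchy-Schwarz and Young's
   inequality (Lipschitz parameters) this gives
     L'_k - L'_{k+1} >= c' (D_h(x_{k+1}, x_k) + D_h(x_k, x_{k-1})),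
   where L' is L with the coefficient c / (2 gamma) of D_h replaced by a possibly
   smaller c'. For convex parameters c' = c / (2 gamma). For Lipschitz ones the
   estimate is in squared norms, and returning to Bregman distances divides by
   the strong convexity modulus of h, so that for a large modulus this argument
   does not make L itself decrease (descent_convex, descent_lipschitz,
   lyap_decrease). Since phi(x_{k+1}) <= L'_k, level boundedness keeps the
   iterates in a ball, where compactness makes the gradients Lipschitz and h
   strongly convex. Hence a_k tends to 0, and L'_k, L_k and phi(x_k) have the same
   limit mu, with mu <= L'_k <= L_k.

   The Kurdyka-Lojasiewicz property of the merit function F yields lower bounds
   for its exact modulus G, and these are needed at two kinds of points. At
   diagonal points (x_k, x_k, x_k) the smooth part of F is flat to first order, so
   F has the subgradient (v, 0, 0) for each regular subgradient v of phi, and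
   optimality in the model provides one with |v| = O(a_k + a_{k-1})
   (merit_subdiff_diag, iterate_subgradient). Being the integral of a nonincreasing
   rate, G plays the role of a concave function: G(b) - G(a) >= (b - a) / |v| up to
   the height of such a point (exact_modulus_gain). The integral is finite because
   the rate is bounded by chord slopes of any desingularizing function, and a
   dyadic sum of these telescopes (KL_rate_finite_integral).

   Let l_k = L'_k - mu. Either phi(x_{k+1}) - mu is at least l_k / 2, and the
   inequality for G applies with l_k / 2 and l_{k+1} / 2; or l_k is dominated by
   the quadratic part, so sqrt(l_k) = O(a_k + a_{k+1}). In both cases
     l_k - l_{k+1} <= B (a_k + a_{k+1}) (H(l_k) - H(l_{k+1})),
     H(t) = 2 G(t / 2) + sqrt(t)
   (KL_step), and with l_k - l_{k+1} >= A (a_{k+1}^2 + a_k^2) the lengths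
   telescope: the tail of the series from index m on is at most a multiple of
   H(l_m) (telescoped_length). So x_k converges to some p; passing to the limit in
   the minimality of x_{k+1} gives mu <= phi(w) + D_hhat(w, p) for all w, hence
   phi(p) = mu and 0 is a regular subgradient of phi at p.

   Finally the square root is absorbed by G: at points (p, p, q) the merit exceeds
   mu by a quantity of order |p - q|^2 and has a subgradient of order |p - q|, so
   sqrt(t) <= C G(t) for small t (sqrt_le_modulus). In positive dimension the
   moduli sigma of h on the ball are bounded above, so the constant M can be
   chosen before sigma. *)

(** * Euclidean geometry of row vectors *)

Section Euclid.
Context {R : realType} {n : nat}.
Implicit Types (u v w : 'rV[R]_n) (a : R).

Lemma dotC u v : dot u v = dot v u.
Proof. by apply: eq_bigr => i _; rewrite mulrC. Qed.

Lemma dotDl u v w : dot (u + v) w = dot u w + dot v w.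
Proof. by rewrite -big_split; apply: eq_bigr => i _; rewrite mxE mulrDl. Qed.

Lemma dotZl a u v : dot (a *: u) v = a * dot u v.
Proof. by rewrite mulr_sumr; apply: eq_bigr => i _; rewrite mxE mulrA. Qed.

Lemma dotNl u v : dot (- u) v = - dot u v.
Proof. by rewrite -scaleN1r dotZl mulN1r. Qed.

Lemma dotBl u v w : dot (u - v) w = dot u w - dot v w.
Proof. by rewrite dotDl dotNl. Qed.

Lemma dotDr u v w : dot w (u + v) = dot w u + dot w v.
Proof. by rewrite dotC dotDl !(dotC w). Qed.

Lemma dotZr a u v : dot u (a *: v) = a * dot u v.
Proof. by rewrite dotC dotZl dotC. Qed.

Lemma dotNr u v : dot u (- v) = - dot u v.
Proof. by rewrite dotC dotNl dotC. Qed.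

Lemma dotBr u v w : dot w (u - v) = dot w u - dot w v.
Proof. by rewrite dotDr dotNr. Qed.

Lemma dot0l u : dot 0 u = 0.
Proof. by rewrite -(scale0r 0) dotZl mul0r. Qed.

Lemma dot0r u : dot u 0 = 0.
Proof. by rewrite dotC dot0l. Qed.

Lemma dotvv_ge0 u : 0 <= dot u u.
Proof. by apply: sumr_ge0 => i _; rewrite -expr2 sqr_ge0. Qed.

Lemma enorm_ge0 u : 0 <= enorm u.
Proof. exact: sqrtr_ge0. Qed.

Lemma enorm_sq u : enorm u ^+ 2 = dot u u.
Proof. by rewrite sqr_sqrtr // dotvv_ge0. Qed.

Lemma enorm0 : enorm (0 : 'rV[R]_n) = 0.
Proof. by rewrite /enorm dot0l sqrtr0. Qed.

Lemma enormZ a u : enorm (a *: u) = `|a| * enorm u.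
Proof. by rewrite /enorm dotZl dotZr mulrA -expr2 sqrtrM ?sqr_ge0 // sqrtr_sqr. Qed.

Lemma enormN u : enorm (- u) = enorm u.
Proof. by rewrite -scaleN1r enormZ normrN1 mul1r. Qed.

Lemma enormB u v : enorm (u - v) = enorm (v - u).
Proof. by rewrite -enormN opprB. Qed.

Lemma enorm_eq0 u : enorm u = 0 -> u = 0.
Proof.
move=> /(congr1 (fun x => x ^+ 2)); rewrite enorm_sq expr0n /= => /eqP.
rewrite psumr_eq0 => [|i _]; last by rewrite -expr2 sqr_ge0.
move=> /allP u0; apply/rowP => i; rewrite mxE; apply/eqP.
by have := u0 i (mem_index_enum i); rewrite implyTb mulf_eq0 orbb.
Qed.

(* Expand the square of |v|^2 u - <u, v> v. *)
Lemma CauchySchwarz u v : `|dot u v| <= enorm u * enorm v.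
Proof.
rewrite -(@ler_pXn2r _ 2) ?nnegrE ?mulr_ge0 ?enorm_ge0 ?normr_ge0 //.
rewrite exprMn !enorm_sq real_normK ?num_real //.
have [v0|v0] := eqVneq (dot v v) 0.
  have -> : v = 0 by apply: enorm_eq0; rewrite /enorm v0 sqrtr0.
  by rewrite !dot0r mulr0 expr0n.
have vgt0 : 0 < dot v v by rewrite lt_def v0 dotvv_ge0.
have := dotvv_ge0 (dot v v *: u - dot u v *: v).
rewrite !(dotBl, dotBr, dotZl, dotZr) (dotC v u) => H.
rewrite -(ler_pM2l vgt0) -subr_ge0; apply: le_trans H _.
by rewrite le_eqVlt; apply/orP; left; apply/eqP; ring.
Qed.

Lemma dot_le u v : dot u v <= enorm u * enorm v.
Proof. exact: le_trans (ler_norm _) (CauchySchwarz u v). Qed.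

Lemma dot_ge u v : - (enorm u * enorm v) <= dot u v.
Proof. by rewrite lerNl -dotNl -(enormN u) dot_le. Qed.

Lemma enormD u v : enorm (u + v) <= enorm u + enorm v.
Proof.
rewrite -(@ler_pXn2r _ 2) ?nnegrE ?addr_ge0 ?enorm_ge0 //.
rewrite sqrrD !enorm_sq dotDl !dotDr (dotC v u) mulr2n.
have := dot_le u v; lra.
Qed.

Lemma enorm_dist w u v : enorm (u - v) <= enorm (u - w) + enorm (w - v).
Proof. by rewrite -[u - v](subrKA w); exact: enormD. Qed.

Lemma coord_le_enorm u i : `|u ord0 i| <= enorm u.
Proof.
rewrite -(@ler_pXn2r _ 2) ?nnegrE ?enorm_ge0 ?normr_ge0 //.
rewrite enorm_sq real_normK ?num_real // /dot (bigD1 i) //= -expr2 lerDl.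
by apply: sumr_ge0 => j _; rewrite -expr2 sqr_ge0.
Qed.

Lemma norm_le_enorm u : `|u| <= enorm u.
Proof.
rewrite [leLHS]/Num.Def.normr/= mx_normrE; apply/bigmax_leP; split => [|[i j] _ /=].
  exact: enorm_ge0.
by rewrite (ord1 i) coord_le_enorm.
Qed.

Lemma enorm_le_norm u : enorm u <= n%:R * `|u|.
Proof.
rewrite -(@ler_pXn2r _ 2) ?nnegrE ?enorm_ge0 ?mulr_ge0 // enorm_sq.
have coord i : `|u ord0 i| <= `|u|.
  rewrite [leRHS]/Num.Def.normr/= mx_normrE.
  exact: (le_bigmax _ (fun ij => `|u ij.1 ij.2|) (ord0, i)).
have : dot u u <= \sum_(i < n) `|u| ^+ 2.
  apply: ler_sum => i _; rewrite -expr2 -(@real_normK _ (u ord0 i)) ?num_real //.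
  by rewrite ler_pXn2r ?nnegrE.
move/le_trans; apply; rewrite sumr_const card_ord -[leLHS]mulr_natl [leRHS]exprMn.
rewrite ler_wpM2r ?sqr_ge0 // -natrX ler_nat.
by case: (n) => // m; rewrite expnS leq_pmulr.
Qed.

Lemma nbhs_enorm u (e : R) : 0 < e -> \forall v \near u, enorm (v - u) < e.
Proof.
move=> e0; have n0 : 0 < n%:R + 1 :> R by rewrite ltr_wpDl.
have : \forall v \near u, ball u (e / (n%:R + 1)) v.
  by apply: nbhsx_ballx; rewrite divr_gt0.
apply: filterS => v; rewrite -ball_normE /ball_ /= => uv.
apply: le_lt_trans (enorm_le_norm _) _.
rewrite distrC; have [->|n1] := eqVneq (n%:R : R) 0; first by rewrite mul0r.
have np : 0 < n%:R :> R by rewrite lt_def n1 ler0n.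
move: uv; rewrite ltr_pdivlMr // => uv; apply: le_lt_trans uv.
by rewrite mulrC ler_wpM2l // lerDl.
Qed.

Lemma enorm_cvg0 {I : Type} (F : set_system I) {FF : Filter F}
    (z : I -> 'rV[R]_n) u :
  z i @[i --> F] --> u -> enorm (z i - u) @[i --> F] --> 0.
Proof.
move=> zu; apply/cvgrPdist_lt => e e0.
have := zu _ (@nbhs_enorm u e e0); rewrite nbhs_filterE /= => H.
near=> i; rewrite sub0r normrN ger0_norm ?enorm_ge0 //.
by near: i.
Unshelve. all: by end_near. Qed.

Lemma enorm_cvg {I : Type} (F : set_system I) {FF : Filter F}
    (z : I -> 'rV[R]_n) u :
  enorm (z i - u) @[i --> F] --> 0 -> z i @[i --> F] --> u.
Proof.
move=> /cvgrPdist_lt zu; apply/cvgrPdist_lt => e e0.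
have := zu _ e0; apply: filterS => i; rewrite sub0r normrN ger0_norm ?enorm_ge0 //.
by rewrite distrC; apply: le_lt_trans; exact: norm_le_enorm.
Qed.

End Euclid.

Section Blocks.
Context {R : realType} {m n : nat}.

Lemma dot_row_mx (u u' : 'rV[R]_m) (v v' : 'rV[R]_n) :
  dot (row_mx u v) (row_mx u' v') = dot u u' + dot v v'.
Proof.
rewrite /dot big_split_ord; congr (_ + _); apply: eq_bigr => i _.
  by rewrite !row_mxEl.
by rewrite !row_mxEr.
Qed.

Lemma enorm_row_mx (u : 'rV[R]_m) (v : 'rV[R]_n) :
  enorm (row_mx u v) <= enorm u + enorm v.
Proof.
rewrite -(@ler_pXn2r _ 2) ?nnegrE ?addr_ge0 ?enorm_ge0 //.
rewrite enorm_sq dot_row_mx -!enorm_sq sqrrD.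
by rewrite -addrA lerD2l lerDr mulrn_wge0 // mulr_ge0 ?enorm_ge0.
Qed.

Lemma enorm_row_mxl (u : 'rV[R]_m) (v : 'rV[R]_n) :
  enorm u <= enorm (row_mx u v).
Proof. by rewrite ler_sqrt ?dotvv_ge0 // dot_row_mx lerDl dotvv_ge0. Qed.

Lemma enorm_row_mxr (u : 'rV[R]_m) (v : 'rV[R]_n) :
  enorm v <= enorm (row_mx u v).
Proof. by rewrite ler_sqrt ?dotvv_ge0 // dot_row_mx lerDr dotvv_ge0. Qed.

End Blocks.

(** * Differential calculus along segments *)

Section Calculus.
Context {R : realType} {n : nat}.
Implicit Types (psi : 'rV[R]_n -> R) (x y u v d : 'rV[R]_n).

Lemma is_derive_line {V : normedModType R} (F : 'rV[R]_n -> V) y v (t : R) :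
  differentiable F (y + t *: v) ->
  is_derive t 1 (fun s : R => F (y + s *: v)) ('D_v F (y + t *: v)).
Proof.
move=> dF.
have E : (fun h : R => h^-1 *: (((fun s : R => F (y + s *: v)) \o shift t) (h *: 1)
            - F (y + t *: v)))
       = (fun h : R => h^-1 *: ((F \o shift (y + t *: v)) (h *: v) - F (y + t *: v))).
  apply/funext => h /=; congr (_ *: (F _ - _)).
  by rewrite [h *: 1]mulr1 scalerDl addrCA addrC.
have D : derivable F (y + t *: v) v by exact: diff_derivable.
split; first by rewrite /derivable E.
by rewrite /derive E.
Qed.

Lemma dot_gradE psi x v : differentiable (psi : 'rV[R]_n -> R^o) x ->
  'D_v (psi : 'rV[R]_n -> R^o) x = dot (grad psi x) v.
Proof.
move=> dx; rewrite deriveE // {1}(row_sum_delta v) linear_sum /=.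
apply: eq_bigr => i _; rewrite linearZ /= mxE deriveE // mulrC.
by [].
Qed.

Lemma is_derive_psi_line psi y v (t : R) :
  (forall z, differentiable (psi : 'rV[R]_n -> R^o) z) ->
  is_derive t (1 : R) (fun s : R => psi (y + s *: v) : R^o)
    (dot (grad psi (y + t *: v)) v).
Proof.
move=> dpsi; have := is_derive_line (dpsi (y + t *: v)).
by rewrite dot_gradE.
Qed.

Lemma is_derive_dotl (F : R -> 'rV[R]_n) (t : R) u d :
  is_derive t 1 F u -> is_derive t 1 (fun s => dot (F s) d : R^o) (dot u d).
Proof.
move=> [dF <-].
have E : (fun h : R => h^-1 *: (((fun s => dot (F s) d : R^o) \o shift t) (h *: 1)
   - (dot (F t) d : R^o))) =
   (fun h : R => dot (h^-1 *: ((F \o shift t) (h *: 1) - F t)) d : R^o).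
  by apply/funext => h /=; rewrite dotZl dotBl.
have C : dot (h^-1 *: ((F \o shift t) (h *: 1) - F t)) d @[h --> 0^'] -->
   (dot ('D_1 F t) d : R^o).
  apply/cvgrPdist_le => e e0.
  have d0 : 0 < enorm d + 1 by rewrite ltr_wpDl ?enorm_ge0.
  have /enorm_cvg0 /cvgrPdist_le H := dF.
  have := H _ (divr_gt0 e0 d0); apply: filterS => h.
  rewrite sub0r normrN ger0_norm ?enorm_ge0 // ler_pdivlMr // => He.
  rewrite -dotBl; apply: le_trans (CauchySchwarz _ _) _.
  apply: le_trans He; rewrite -enormN opprB ler_wpM2l ?enorm_ge0 //.
  by rewrite lerDl.
split; first by rewrite /derivable E; apply/cvg_ex; eexists; exact: C.
by rewrite /derive E; apply: cvg_lim.
Qed.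

Definition breg psi x y : R := psi x - psi y - dot (grad psi y) (x - y).

Definition twice_C psi :=
  [/\ forall x, differentiable (psi : 'rV[R]_n -> R^o) x,
      forall x, differentiable (grad psi) x & continuous (hessian psi)].

Lemma MVT01 (f df : R -> R) :
  (forall t : R, is_derive t (1 : R) (f : R -> R^o) (df t)) ->
  exists2 t, 0 <= t <= 1 & f 1 - f 0 = df t.
Proof.
move=> H; have [|t] := @MVT_segment R f df 0 1 ler01 (fun t _ => H t).
  apply: continuous_subspaceT => t.
  apply: differentiable_continuous; apply/derivable1_diffP.
  by have [] := H t.
by rewrite in_itv /= subr0 mulr1 => t01 E; exists t.
Qed.

Lemma psi_MVT psi x y : (forall z, differentiable (psi : 'rV[R]_n -> R^o) z) ->
  exists2 t : R, 0 <= t <= 1 &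
    psi x - psi y = dot (grad psi (y + t *: (x - y))) (x - y).
Proof.
move=> dpsi; have [|t t01 E] := @MVT01 (fun s => psi (y + s *: (x - y)))
  (fun t => dot (grad psi (y + t *: (x - y))) (x - y)).
  by move=> t; exact: is_derive_psi_line.
exists t => //; rewrite -E scale1r scale0r addr0.
by rewrite (addrC y) subrK.
Qed.

Lemma grad_MVT psi x y d : (forall z, differentiable (grad psi) z) ->
  exists2 t : R, 0 <= t <= 1 &
    dot (grad psi x - grad psi y) d
    = dot ((x - y) *m hessian psi (y + t *: (x - y))) d.
Proof.
move=> dpsi; have [|t t01 E] := @MVT01 (fun s => dot (grad psi (y + s *: (x - y))) d)
  (fun t => dot ((x - y) *m hessian psi (y + t *: (x - y))) d).
  move=> t; apply: is_derive_dotl.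
  have := is_derive_line (dpsi (y + t *: (x - y))).
  by rewrite deriveEjacobian.
exists t => //; rewrite -E scale1r scale0r addr0 dotBl.
by rewrite (addrC y) subrK.
Qed.

End Calculus.

(** * Quantitative consequences of twice continuous differentiability *)

Section Bounds.
Context {R : realType} {n : nat}.
Implicit Types (psi : 'rV[R]_n -> R) (x y u v d : 'rV[R]_n).

Lemma enorm_continuous : continuous (enorm : 'rV[R]_n -> R).
Proof.
move=> u; apply/(@cvgrPdist_le _ _ _ (nbhs u)) => e e0.
near=> v; have uv : enorm (v - u) < e by near: v; exact: nbhs_enorm.
rewrite ler_norml; apply/andP; split.
  have := enorm_dist u v 0; rewrite !subr0; move: uv; lra.
have := enorm_dist v u 0; rewrite !subr0 (enormB u v); move: uv; lra.
Unshelve. all: by end_near. Qed.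

Lemma compact_enorm_le rho : compact [set u : 'rV[R]_n | enorm u <= rho].
Proof.
apply: bounded_closed_compact.
  exists rho; split; first exact: num_real.
  move=> M rM u /= ur; apply: le_trans (norm_le_enorm _) _.
  exact: le_trans ur (ltW rM).
apply: (@closed_comp _ _ enorm [set x | x <= rho]) => [u _|].
  exact: enorm_continuous.
exact: closed_le.
Qed.

Lemma compact_unit_sphere : compact [set u : 'rV[R]_n | enorm u = 1].
Proof.
apply: (subclosed_compact _ (@compact_enorm_le 1)).
  apply: (@closed_comp _ _ enorm [set x | x = 1]) => [u _|].
    exact: enorm_continuous.
  exact: closed_eq.
by move=> u /= ->.
Qed.

Lemma quad_form_le (A : 'M[R]_n) u d :
  `|dot (u *m A) d| <= n%:R ^+ 2 * `|A| * enorm u * enorm d.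
Proof.
have entry i j : `|A i j| <= `|A|.
  rewrite [leRHS]/Num.Def.normr/= mx_normrE.
  exact: (le_bigmax _ (fun ij => `|A ij.1 ij.2|) (i, j)).
have : `|dot (u *m A) d| <= \sum_(j < n) \sum_(i < n) (`|A| * enorm u * enorm d).
  apply: le_trans (ler_norm_sum _ _ _) _; apply: ler_sum => j _.
  rewrite mxE normrM.
  apply: (@le_trans _ _ ((\sum_(i < n) `|u ord0 i * A i j|) * `|d ord0 j|)).
    by rewrite ler_wpM2r // ler_norm_sum.
  rewrite mulr_suml; apply: ler_sum => i _; rewrite normrM.
  apply: ler_pM => //.
    by rewrite mulrC ler_pM // coord_le_enorm.
  exact: coord_le_enorm.
move/le_trans; apply.
by rewrite !sumr_const card_ord -mulrnA -[leLHS]mulr_natl natrM -expr2 !mulrA.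
Qed.

Lemma segment_le rho x y (t : R) : enorm x <= rho -> enorm y <= rho ->
  0 <= t <= 1 -> enorm (y + t *: (x - y)) <= rho.
Proof.
move=> xr yr /andP[t0 t1].
have -> : y + t *: (x - y) = t *: x + (1 - t) *: y.
  by rewrite scalerBr scalerBl scale1r addrCA.
apply: le_trans (enormD _ _) _; rewrite !enormZ !ger0_norm ?subr_ge0 //.
have := ler_wpM2l t0 xr.
have : (1 - t) * enorm y <= (1 - t) * rho by rewrite ler_wpM2l // subr_ge0.
lra.
Qed.

Definition hessian_le psi rho K := forall z u d, enorm z <= rho ->
  `|dot (u *m hessian psi z) d| <= K * enorm u * enorm d.

Lemma hessian_leW psi rho K K' : K <= K' ->
  hessian_le psi rho K -> hessian_le psi rho K'.
Proof.
move=> KK' H z u d zr; apply: le_trans (H z u d zr) _.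
by rewrite ler_wpM2r ?enorm_ge0 // ler_wpM2r ?enorm_ge0.
Qed.

(** By compactness of the ball. *)
Lemma hessian_bounded psi rho : twice_C psi ->
  exists2 K, 0 < K & hessian_le psi rho K.
Proof.
move=> [_ dg cH].
have cN : {within [set u : 'rV[R]_n | enorm u <= rho],
    continuous (fun z => `|hessian psi z|)}.
  by apply: continuous_subspaceT => z; exact: (cvg_norm (cH z)).
have [[z0 z0r]|noball] := pselect ([set u : 'rV[R]_n | enorm u <= rho] !=set0);
  last first.
  by exists 1 => // z u d zr; exfalso; apply: noball; exists z.
have [z _ zmax] := EVT_max_rV (ex_intro _ z0 z0r) (@compact_enorm_le rho) cN.
exists (n%:R ^+ 2 * `|hessian psi z| + 1).
  by rewrite ltr_wpDl // mulr_ge0 // sqr_ge0.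
move=> y u d yr; apply: le_trans (quad_form_le _ _ _) _.
rewrite ler_wpM2r ?enorm_ge0 // ler_wpM2r ?enorm_ge0 //.
have := zmax y; rewrite inE => /(_ yr) H.
by apply: (@le_trans _ _ (n%:R ^+ 2 * `|hessian psi z|));
  [rewrite ler_wpM2l ?sqr_ge0 | rewrite lerDl].
Qed.

Lemma grad_lipschitz psi rho K : twice_C psi -> hessian_le psi rho K ->
  forall x y, enorm x <= rho -> enorm y <= rho ->
    enorm (grad psi x - grad psi y) <= K * enorm (x - y).
Proof.
move=> [_ dg _] HK x y xr yr; set d := grad psi x - grad psi y.
have [t t01 E] := grad_MVT x y d dg.
have H := HK _ (x - y) d (segment_le xr yr t01).
have [d0|d0] := eqVneq (enorm d) 0.
  rewrite d0; have := HK x (x - y) (x - y) xr.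
  have [xy|xy] := eqVneq (enorm (x - y)) 0; first by rewrite xy !mulr0.
  have xy0 : 0 < enorm (x - y) by rewrite lt_def xy enorm_ge0.
  by move=> /(le_trans (normr_ge0 _)); rewrite pmulr_lge0.
have dgt0 : 0 < enorm d by rewrite lt_def d0 enorm_ge0.
rewrite -(ler_pM2r dgt0) -expr2 enorm_sq {2}/d dotC E.
exact: le_trans (ler_norm _) H.
Qed.

Lemma breg_le psi rho K : twice_C psi -> hessian_le psi rho K ->
  forall x y, enorm x <= rho -> enorm y <= rho ->
    `|breg psi x y| <= K * enorm (x - y) ^+ 2.
Proof.
move=> C2psi HK x y xr yr; have [d _ _] := C2psi.
have [t t01 E] := psi_MVT x y d.
rewrite /breg E -dotBl; apply: le_trans (CauchySchwarz _ _) _.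
rewrite expr2 mulrA ler_wpM2r ?enorm_ge0 //.
apply: le_trans (grad_lipschitz C2psi HK (segment_le xr yr t01) yr) _.
have K0 := le_trans (enorm_ge0 _) (grad_lipschitz C2psi HK xr yr).
have /andP[t0 t1] := t01.
rewrite addrC addKr enormZ ger0_norm // mulrCA.
by rewrite ler_piMl.
Qed.

(** The form (z, u) |-> <u H(z), u> attains a positive minimum on the product of
   the ball and the unit sphere. *)
Lemma grad_strongly_monotone psi : twice_C psi ->
  (forall z, posdef (hessian psi z)) -> forall rho,
  exists2 s, 0 < s & forall x y, enorm x <= rho -> enorm y <= rho ->
    s * enorm (x - y) ^+ 2 <= dot (grad psi x - grad psi y) (x - y).
Proof.
move=> [_ dg cH] pH rho.
pose A := [set u : 'rV[R]_n | enorm u <= rho] `*` [set u : 'rV[R]_n | enorm u = 1].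
have cA : compact A.
  by apply: compact_setX; [exact: compact_enorm_le|exact: compact_unit_sphere].
pose q (p : 'rV[R]_n * 'rV[R]_n) : R := dot (p.2 *m hessian psi p.1) p.2.
have cq : continuous q.
  move=> p; rewrite /continuous_at /q /dot.
  apply: cvg_big => [|j _]; first exact: add_continuous.
  apply: cvgM; last first.
    apply: (cvg_comp snd (fun u : 'rV[R]_n => u ord0 j)); first exact: cvg_snd.
    exact: coord_continuous.
  under eq_fun do rewrite mxE; rewrite mxE.
  apply: cvg_big => [|i _]; first exact: add_continuous.
  apply: cvgM.
    apply: (cvg_comp snd (fun u : 'rV[R]_n => u ord0 i)); first exact: cvg_snd.
    exact: coord_continuous.
  apply: (cvg_comp (fun p : 'rV[R]_n * 'rV[R]_n => hessian psi p.1)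
     (fun u : 'M[R]_n => u i j)); last exact: coord_continuous.
  by apply: (cvg_comp fst (hessian psi)); [exact: cvg_fst|exact: cH].
have [A0|A0] := pselect (A !=set0); last first.
  (* Either the ball is empty, or the space is a point. *)
  exists 1 => // x y xr yr; have [xy|xy] := eqVneq (enorm (x - y)) 0.
    by rewrite (enorm_eq0 xy) dot0r enorm0 expr0n mulr0.
  exfalso; apply: A0; exists (x, (enorm (x - y))^-1 *: (x - y)); split => //=.
  by rewrite enormZ ger0_norm ?invr_ge0 ?enorm_ge0 // mulVf.
have [[z u]] := compact_EVT_min A0 cA (continuous_subspaceT cq).
rewrite inE => -[/= zr u1] qmin.
exists (q (z, u)).
  apply: (pH z u); apply/eqP => u0; move: u1; rewrite u0 enorm0 => /esym/eqP.
  by rewrite oner_eq0.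
move=> x y xr yr; have [xy|xy] := eqVneq (enorm (x - y)) 0.
  by rewrite (enorm_eq0 xy) dot0r enorm0 expr0n mulr0.
have [t t01 ->] := grad_MVT x y (x - y) dg.
have := qmin (y + t *: (x - y), (enorm (x - y))^-1 *: (x - y)).
rewrite inE => /(_ _) H.
have {H} : q (z, u) <= q (y + t *: (x - y), (enorm (x - y))^-1 *: (x - y)).
  apply: H; split => /=; first exact: segment_le.
  by rewrite enormZ ger0_norm ?invr_ge0 ?enorm_ge0 // mulVf.
rewrite [leRHS]/q /= -scalemxAl dotZl dotZr mulrA -expr2 => H.
have p2 : 0 < enorm (x - y) ^+ 2 by rewrite exprn_gt0 // lt_def xy enorm_ge0.
by rewrite -ler_pdivlMr // mulrC -exprVn.
Qed.

End Bounds.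

(** * Bregman distances: linearity and convexity *)

Section Linear.
Context {R : realType} {n : nat}.
Implicit Types (psi phi : 'rV[R]_n -> R) (x y v : 'rV[R]_n) (a b : R).

Definition lincomb a b psi phi x : R := a * psi x + b * phi x.

Lemma differentiable_lincomb {V : normedModType R} (F G : 'rV[R]_n -> V) a b x :
  differentiable F x -> differentiable G x ->
  differentiable (fun z => a *: F z + b *: G z) x.
Proof.
move=> dF dG; apply: (@differentiableD _ _ _ (a \*: F) (b \*: G)).
  exact: differentiableZ.
exact: differentiableZ.
Qed.

Lemma derive_lincomb {V : normedModType R} (F G : 'rV[R]_n -> V) a b x v :
  differentiable F x -> differentiable G x ->
  'D_v (fun z => a *: F z + b *: G z) x = a *: 'D_v F x + b *: 'D_v G x.
Proof.
move=> dF dG.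
have DF : derivable F x v by exact: diff_derivable.
have DG : derivable G x v by exact: diff_derivable.
by rewrite -(deriveZ _ DF) -(deriveZ _ DG) -deriveD //; exact: derivableZ.
Qed.

Lemma grad_lincomb psi phi a b x :
  differentiable (psi : 'rV[R]_n -> R^o) x ->
  differentiable (phi : 'rV[R]_n -> R^o) x ->
  grad (lincomb a b psi phi) x = a *: grad psi x + b *: grad phi x.
Proof.
move=> dpsi dphi; apply/rowP => i; rewrite !mxE.
exact: (derive_lincomb a b _ dpsi dphi).
Qed.

Lemma eq_mulmx (A B : 'M[R]_n) : (forall v : 'rV[R]_n, v *m A = v *m B) -> A = B.
Proof. by move=> AB; apply/row_matrixP => i; rewrite !rowE AB. Qed.

Lemma hessianE psi x v : differentiable (grad psi) x ->
  v *m hessian psi x = 'D_v (grad psi) x.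
Proof. by move=> d; rewrite /hessian deriveEjacobian. Qed.

Lemma twice_C_lincomb psi phi a b :
  twice_C psi -> twice_C phi -> twice_C (lincomb a b psi phi).
Proof.
move=> [d1 g1 h1] [d2 g2 h2].
have gE : grad (lincomb a b psi phi) = (fun x => a *: grad psi x + b *: grad phi x).
  by apply/funext => x; rewrite grad_lincomb.
have dG x : differentiable (grad (lincomb a b psi phi)) x.
  by rewrite gE; exact: differentiable_lincomb.
split; first by move=> x; exact: (@differentiable_lincomb R^o).
  exact: dG.
have -> : hessian (lincomb a b psi phi)
        = (fun x => a *: hessian psi x + b *: hessian phi x).
    apply/funext => x; apply: eq_mulmx => v.
    rewrite (hessianE _ (dG x)) gE derive_lincomb //.
    rewrite -(hessianE _ (g1 x)) -(hessianE _ (g2 x)).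
    by rewrite (scalemxAr a) (scalemxAr b) mulmxDr.
  move=> x; exact: (cvgD (cvgZl_tmp (h1 x)) (cvgZl_tmp (h2 x))).
Qed.

Lemma breg_lincomb psi phi a b x y :
  twice_C psi -> twice_C phi ->
  breg (lincomb a b psi phi) x y = a * breg psi x y + b * breg phi x y.
Proof.
move=> [d1 _ _] [d2 _ _].
rewrite /breg grad_lincomb // /lincomb dotDl !dotZl; ring.
Qed.

Definition half_sq x : R := enorm x ^+ 2 / 2.

Lemma differentiable_half_sq x : differentiable (half_sq : 'rV[R]_n -> R^o) x.
Proof.
have -> : (half_sq : 'rV[R]_n -> R^o) =
    2^-1 \*: (\sum_(i < n) (fun z : 'rV[R]_n => z ord0 i * z ord0 i : R^o)).
  apply/funext => z; rewrite /half_sq enorm_sq /dot mulrC; congr (_ * _).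
  by rewrite fct_sumE.
apply: differentiableZ; apply: differentiable_sum => i.
by apply: differentiableM; exact: differentiable_coord.
Qed.

Lemma half_sq_line x v (s : R) :
  half_sq (x + s *: v) = half_sq x + s * dot x v + s ^+ 2 * half_sq v.
Proof.
by rewrite /half_sq !enorm_sq !(dotDl, dotDr, dotZl, dotZr) (dotC v x); field.
Qed.

Lemma grad_half_sq x : grad half_sq x = x.
Proof.
apply/rowP => i; rewrite mxE; set v := delta_mx ord0 i.
have H : is_derive (0 : R) (1 : R) (fun s => half_sq (x + s *: v) : R^o) ('D_v half_sq x).
  have := @is_derive_line R n R^o half_sq x v 0.
  rewrite scale0r addr0; apply; exact: differentiable_half_sq.
have E : (fun s : R => half_sq (x + s *: v)) =
   (fun s => half_sq x + s * dot x v + s ^+ 2 * half_sq v).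
  by apply/funext => s; exact: half_sq_line.
have H2 : is_derive (0 : R) (1 : R)
    (fun s : R => half_sq x + s * dot x v + s ^+ 2 * half_sq v : R^o) (dot x v).
  by apply: is_derive_eq; rewrite /GRing.scale /=; ring.
rewrite E in H; have [_ <-] := H; have [_ ->] := H2.
rewrite /dot (bigD1 i) //= big1 => [|j ji]; first by rewrite mxE !eqxx addr0 mulr1.
by rewrite mxE eqxx /= (negbTE ji) mulr0.
Qed.

Lemma twice_C_half_sq : twice_C half_sq.
Proof.
have gE : grad half_sq = id by apply/funext => x; exact: grad_half_sq.
have dG x : differentiable (grad half_sq) x by rewrite gE.
split; first exact: differentiable_half_sq.
  exact: dG.
have -> : hessian half_sq = (fun=> 1%:M).
  apply/funext => x; apply: eq_mulmx => v.
  by rewrite (hessianE _ (dG x)) gE derive_id mulmx1.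
exact: cst_continuous.
Qed.

Lemma breg_half_sq x y : breg half_sq x y = enorm (x - y) ^+ 2 / 2.
Proof.
rewrite /breg grad_half_sq /half_sq !enorm_sq !(dotBl, dotBr) (dotC y x).
by field.
Qed.

End Linear.

Section Convexity.
Context {R : realType} {n : nat}.
Implicit Types (psi : 'rV[R]_n -> R) (S : set 'rV[R]_n) (x y : 'rV[R]_n).

Lemma convex_functionP {E : lmodType R} (S : set E) (f : E -> R) :
  convex_function (S : set (convex_lmodType E)) f <->
  forall (x y : E) t, S x -> S y -> 0 <= t <= 1 ->
    f (t *: x + (1 - t) *: y) <= t * f x + (1 - t) * f y.
Proof.
split=> [cf x y t Sx Sy /andP[t0 t1]|cf t x y].
  have /(_ (Itv01 t0 t1) x y) := cf; rewrite !inE; exact.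
rewrite !inE => Sx Sy; apply: cf => //.
by rewrite ge0 le1.
Qed.

(** The gradient inequality, got from the difference quotients along the
   segment from y to x. *)
Lemma convex_breg_ge0 S psi : convex_function S psi ->
  (forall z, differentiable (psi : 'rV[R]_n -> R^o) z) ->
  forall x y, S x -> S y -> 0 <= breg psi x y.
Proof.
move=> /convex_functionP cf dpsi x y Sx Sy; rewrite /breg subr_ge0.
have [D <-] : is_derive (0 : R) (1 : R)
    (fun s : R => psi (y + s *: (x - y)) : R^o) (dot (grad psi y) (x - y)).
  by have := is_derive_psi_line y (x - y) 0 dpsi; rewrite scale0r addr0.
have := cvg_dnbhs_at_right D => /cvgr_to_le; apply.
near=> t; have t0 : 0 < t by near: t; exact: nbhs_right_gt.
have t1 : t <= 1 by near: t; exact: nbhs_right_le.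
rewrite /= scale0r !addr0 /GRing.scale /= mulr1 mulrC ler_pdivrMr //.
have := cf x y t Sx Sy; rewrite (ltW t0) t1 => /(_ isT).
have -> : t *: x + (1 - t) *: y = y + t *: (x - y).
  by rewrite scalerBr scalerBl scale1r addrCA.
lra.
Unshelve. all: by end_near. Qed.

Lemma breg_ge0_convex S psi :
  (forall x y (t : R), S x -> S y -> 0 <= t <= 1 -> S (t *: x + (1 - t) *: y)) ->
  (forall x y, S x -> S y -> 0 <= breg psi x y) ->
  convex_function S psi.
Proof.
move=> cS H; apply/convex_functionP => x y t Sx Sy t01.
have Sm := cS _ _ _ Sx Sy t01; set m := _ + _ in Sm *.
have /andP[t0 t1] := t01; have s0 : 0 <= 1 - t by rewrite subr_ge0.
have := ler_wpM2l t0 (H _ _ Sx Sm); have := ler_wpM2l s0 (H _ _ Sy Sm).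
rewrite /breg !mulr0.
have : t * dot (grad psi m) (x - m) + (1 - t) * dot (grad psi m) (y - m) = 0.
  rewrite -!dotZr -dotDr !scalerBr addrACA -opprD -scalerDl.
  by rewrite (addrC t) subrK scale1r subrr dot0r.
lra.
Qed.

End Convexity.

(** * Integrals of nonincreasing rates *)

Section AntitoneIntegral.
Context {R : realType}.
Variable rho : R -> \bar R.
Hypothesis rho_ge0 : forall s, (0 <= rho s)%E.
Hypothesis rho_nincr : forall s t, s <= t -> (rho t <= rho s)%E.
Local Notation mu := (@lebesgue_measure R).
Local Notation I t := (\int[mu]_(s in `]0%R, t[) rho s)%E.

Lemma antitone_measurable (D : set R) : measurable D -> measurable_fun D rho.
Proof.
move=> mD; apply: (measurability _ (ErealGenOInfty.measurableE R)).
move=> /= _ [_ [a ->]] <-; apply: measurableI => //.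
rewrite preimage_itvoy; apply: is_interval_measurable => s t /= _ ta u /andP[_ ut].
exact: lt_le_trans ta (rho_nincr ut).
Qed.

(** With k the rate at some point beyond b this is the inequality by which the
   integral behaves like a concave function. *)
Lemma integral_increment (a b k : R) : 0 <= a -> a <= b -> 0 <= k ->
  (forall s, s < b -> (k%:E <= rho s)%E) ->
  (I a + (k * (b - a))%:E <= I b)%E.
Proof.
move=> a0 ab k0 kr.
have -> : (k * (b - a))%:E = (\int[mu]_(s in `]a, b[) cst k%:E s)%E.
  rewrite integral_cst //= lebesgue_measure_itv /= lte_fin.
  have [lab|ba] := ltP a b; first by rewrite -EFinB -EFinM.
  by rewrite (le_anti (introT andP (conj ab ba))) subrr mulr0 mule0.
apply: (@le_trans _ _ (I a + \int[mu]_(s in `]a, b[) rho s)%E).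
  rewrite leeD2l //; apply: ge0_le_integral => //.
  - exact: antitone_measurable.
  - by move=> s /=; rewrite in_itv /= => /andP[_ sb]; exact: kr.
rewrite -ge0_integral_setU //.
- apply: ge0_subset_integral => //; first exact: measurableU.
    exact: antitone_measurable.
  move=> s [] /=; rewrite !in_itv /= => /andP[s1 s2]; apply/andP; split => //.
    exact: lt_le_trans s2 ab.
  exact: le_lt_trans a0 s1.
- by apply: antitone_measurable; exact: measurableU.
- rewrite disj_set2E; apply/eqP/seteqP; split => // s [] /=.
  by rewrite !in_itv /= => /andP[_ sa] /andP[/lt_trans/(_ sa)]; rewrite ltxx.
Qed.

(** A dyadic decomposition of ]0, t[ bounds the integral by a telescoping sum. *)
Lemma integral_finite (psi : R -> R) (t : R) : 0 < t ->
  (forall s, 0 < s -> s < t -> 0 <= psi s) ->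
  (forall s, 0 < s -> s < t ->
     (rho s <= ((psi s - psi (s / 2)) / (s / 2))%:E)%E) ->
  (I t < +oo)%E.
Proof.
move=> t0 psi0 rpsi.
pose p i : R := t / 2 ^+ i.
have p0 i : 0 < p i by rewrite divr_gt0 // exprn_gt0.
have pS i : p i.+1 = p i / 2 by rewrite /p exprS invfM mulrA mulrAC.
have plt i : p i.+1 < p i by rewrite pS ltr_pdivrMr // ltr_pMr // ltr1n.
have pt i : p i.+1 < t.
  by elim: i => [|i IH]; [rewrite pS /p expr0 divr1 ltr_pdivrMr // ltr_pMr // ltr1n
    |exact: lt_trans (plt _) IH].
pose D i : set R := `[p i, t[%classic.
have mD i : measurable (D i) by exact: measurable_itv.
have DU : \bigcup_i D i = `]0, t[%classic.
  apply/seteqP; split => s /=.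
    move=> [i _]; rewrite /D /= !in_itv /= => /andP[ps ->]; rewrite andbT.
    exact: lt_le_trans (p0 i) ps.
  rewrite in_itv /= => /andP[s0 st].
  have [i Hi] : exists i : nat, t / s < 2 ^+ i.
    exists (Num.truncn (t / s)).+1.
    apply: lt_le_trans (truncnS_gt _) _; rewrite -natrX ler_nat.
    exact/ltnW/ltn_expl.
  exists i => //; rewrite /D /= in_itv /= st andbT /p.
  by rewrite ler_pdivrMr ?exprn_gt0 // mulrC -ler_pdivrMr // ltW.
have bound i : (\int[mu]_(s in D i) rho s <= (2 * (psi (p 1%N) - psi (p i.+1)))%:E)%E.
  elim: i => [|i IH].
    rewrite subrr mulr0 /D /p expr0 divr1 set_itvco0 ?integral_set0 //.
  have -> : D i.+1 = `[p i.+1, p i[%classic `|` D i.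
    apply/seteqP; split => s /=; rewrite /D /= !in_itv /=.
      move=> /andP[h1 h2]; case: (ltP s (p i)) => h3.
        by left; rewrite h1.
      by right; rewrite h2.
    have pit : p i <= t.
      by case: (i) => [|j]; [rewrite /p expr0 divr1 | rewrite ltW].
    move=> [/andP[h1 h2]|/andP[h1 h2]].
      by rewrite h1 (lt_le_trans h2 pit).
    by rewrite h2 (le_trans (ltW (plt i)) h1).
  rewrite ge0_integral_setU //; last 2 first.
  - by apply: antitone_measurable; exact: measurableU.
  - rewrite disj_set2E; apply/eqP/seteqP; split => // s [] /=.
    rewrite /D /= !in_itv /= => /andP[_ sa] /andP[/le_lt_trans/(_ sa)].
    by rewrite ltxx.
  set q := p i.+1.
  apply: (@le_trans _ _ ((2 * (psi q - psi (q / 2)))%:E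
      + (2 * (psi (p 1%N) - psi (p i.+1)))%:E)%E); last first.
    by rewrite -EFinD lee_fin -/q (pS i.+1) -/q; lra.
  apply: leeD => //.
  have -> : (2 * (psi q - psi (q / 2)))%:E =
     (\int[mu]_(s in `[q, p i[) cst ((psi q - psi (q / 2)) / (q / 2))%:E s)%E.
    rewrite integral_cst //= lebesgue_measure_itv /= lte_fin plt.
    rewrite -EFinB -EFinM; congr EFin.
    have -> : p i = 2 * q by rewrite /q pS mulrC divfK.
    by field; rewrite gt_eqF // p0.
  have rq := rpsi q (p0 _) (pt _).
  apply: ge0_le_integral => //.
  - exact: antitone_measurable.
  - move=> s /=; rewrite in_itv /= => /andP[qs _].
    exact: le_trans (rho_nincr qs) rq.
  exact: mD.
have cv : (\int[mu]_(s in D i) rho s)%E @[i --> \oo] -->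
    (\int[mu]_(s in \bigcup_i D i) rho s)%E.
  apply: ge0_nondecreasing_set_cvg_integral => //.
    apply/nondecreasing_seqP => i; apply/subsetPset => s.
    rewrite /D /= !in_itv /= => /andP[ps ->]; rewrite andbT.
    exact: le_trans (ltW (plt i)) ps.
  by move=> i; exact: antitone_measurable.
rewrite -DU.
apply: (@le_lt_trans _ _ (2 * psi (p 1%N))%:E); last exact: ltry.
apply: (cvge_to_le cv).
near=> i; apply: le_trans (bound i) _; rewrite lee_fin ler_pM2l // gerBl.
exact: psi0.
Unshelve. all: by end_near. Qed.

End AntitoneIntegral.

(** * The exact modulus of a Kurdyka-Lojasiewicz function *)

Section KLmodulus.
Context {R : realType} {m : nat}.
Variables (F : 'rV[R]_m -> \bar R) (U : set 'rV[R]_m) (eta : \bar R).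

Lemma setdist_ge0 (z : 'rV[R]_m) S : (0 <= setdist z S)%E.
Proof.
by apply: le_ereal_inf_tmp => _ [w _ <-]; rewrite lee_fin enorm_ge0.
Qed.

Lemma setdist0_le (v : 'rV[R]_m) S : S v -> (setdist 0 S <= (enorm v)%:E)%E.
Proof.
move=> Sv; apply: ereal_inf_lbound; exists v => //.
by rewrite sub0r enormN.
Qed.

Lemma KL_rate_ge0 mu s : (0 <= KL_rate F U mu eta s)%E.
Proof. by apply: ereal_sup_ubound; left. Qed.

Lemma KL_rate_nincr mu s t : s <= t ->
  (KL_rate F U mu eta t <= KL_rate F U mu eta s)%E.
Proof.
move=> st; apply: ge_ereal_sup => _ [->|[x [Ux /andP[tx xe]] <-]].
  exact: KL_rate_ge0.
apply: ereal_sup_ubound; right; exists x => //; split => //.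
by rewrite xe andbT; apply: le_trans tx; rewrite lee_fin.
Qed.

Section Desingularizing.
Variables (psi : R -> R) (dpsi : concave_desingularizing eta psi).

Lemma co_intervalW (s t : R) : 0 <= s -> s <= t -> (t%:E < eta)%E -> co_interval eta s.
Proof. by move=> s0 st te; split=> //; apply: le_lt_trans te; rewrite lee_fin. Qed.

Lemma desing_chord (a b c : R) : 0 <= a -> a <= b -> b <= c -> (c%:E < eta)%E ->
  psi a * (c - b) + psi c * (b - a) <= psi b * (c - a).
Proof.
move=> a0 ab bc ce.
have [ac|ca] := ltP a c; last first.
  have bE : b = a by lra.
  have cE : c = a by lra.
  by rewrite bE cE !subrr !mulr0 addr0.
have /convex_functionP cv := desing_concave dpsi.
have ac0 : 0 < c - a by rewrite subr_gt0.
have Ia : co_interval eta a by apply: (co_intervalW (t := c)) => //; exact: ltW.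
have Ic : co_interval eta c by split => //; lra.
have := cv a c ((c - b) / (c - a)) Ia Ic.
have -> : 0 <= (c - b) / (c - a) <= 1.
  apply/andP; split; first by apply: divr_ge0; lra.
  by rewrite ler_pdivrMr // mul1r lerD2l lerN2.
move=> /(_ isT); rewrite /GRing.scale /=.
have -> : (c - b) / (c - a) * a + (1 - (c - b) / (c - a)) * c = b.
  by field; rewrite gt_eqF.
rewrite -(ler_pM2r ac0) => H.
have : psi b * (c - a) >= ((c - b) / (c - a) * psi a + (1 - (c - b) / (c - a)) * psi c) * (c - a).
  by move: H; lra.
apply: le_trans; rewrite le_eqVlt; apply/orP; left; apply/eqP.
by field; rewrite gt_eqF.
Qed.

(** Chords of a concave function have decreasing slopes, so the left difference
   quotients at t are monotone and bounded by any chord lying further left. *)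
Lemma left_derive_le (s t : R) : 0 < s -> s <= t -> (t%:E < eta)%E ->
  left_derive psi t <= (psi s - psi (s / 2)) / (s / 2).
Proof.
move=> s0 st te; have t0 : 0 < t by exact: lt_le_trans st.
have s2 : 0 < s / 2 by rewrite divr_gt0.
rewrite /left_derive; apply: limr_le.
  rewrite -is_cvgNE; apply: nondecreasing_at_left_is_cvgr.
    near=> x => u v; rewrite !in_itv /= => /andP[xu u0] /andP[xv v0] uv.
    have xt : - t <= x by near: x; apply: nbhs_left_ge; rewrite oppr_lt0.
    have nu0 : 0 < - u by rewrite oppr_gt0.
    have nv0 : 0 < - v by rewrite oppr_gt0.
    rewrite lerN2 -(ler_pM2r nu0) -(ler_pM2r nv0).
    have -> : (psi (t + v) - psi t) / v * - u * - v = (psi t - psi (t + v)) * - u.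
      by field; rewrite lt_eqF.
    have -> : (psi (t + u) - psi t) / u * - u * - v = (psi t - psi (t + u)) * - v.
      by field; rewrite lt_eqF.
    have := @desing_chord (t + u) (t + v) t.
    move=> /(_ _ _ _ te) H.
    have {H} : psi (t + u) * (t - (t + v)) + psi t * (t + v - (t + u)) <=
        psi (t + v) * (t - (t + u)) by apply: H; lra.
    lra.
  near=> x; exists 0 => _ [u /= + <-]; rewrite in_itv /= => /andP[xu u0].
  have xt : - t <= x by near: x; apply: nbhs_left_ge; rewrite oppr_lt0.
  rewrite oppr_le0 -[X in 0 <= X]mulrNN -invrN divr_ge0 //; last lra.
  rewrite opprB subr_ge0; apply/ltW/(desing_increasing dpsi).
  - by apply: (co_intervalW (t := t)) => //; lra.
  - by split => //; exact: ltW.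
  - lra.
near=> x; have x0 : x < 0 by near: x; exact: nbhs_left_lt.
have xs : - (t - s / 2) <= x.
  by near: x; apply: nbhs_left_ge; rewrite oppr_lt0 subr_gt0; lra.
have nx0 : 0 < - x by rewrite oppr_gt0.
have H1 : psi (s / 2) * (t - s) + psi t * (s - s / 2) <= psi s * (t - s / 2).
  by apply: desing_chord => //; lra.
have H2 : psi (s / 2) * (t - (t + x)) + psi t * (t + x - s / 2)
    <= psi (t + x) * (t - s / 2).
  by apply: desing_chord => //; lra.
have ts : 0 < t - s / 2 by lra.
(* Both slopes are compared with that of the chord over [s / 2, t]. *)
apply: (@le_trans _ _ ((psi t - psi (s / 2)) / (t - s / 2))).
  have -> : (psi (t + x) - psi t) / x = (psi t - psi (t + x)) / (- x).
    by field; rewrite lt_eqF.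
  rewrite ler_pdivrMr // mulrAC ler_pdivlMr //; lra.
rewrite ler_pdivrMr // mulrAC ler_pdivlMr //; lra.
Unshelve. all: by end_near. Qed.

End Desingularizing.

Variables (V : set 'rV[R]_m) (mu : R).
Hypothesis KL : setwise_KL F V U mu%:E eta.
Local Notation G := (exact_modulus F U mu%:E eta).
Local Notation rho := (KL_rate F U mu%:E eta).

(** The value infinity of the integral would be sent to 0 by fine, so the exact
   modulus carries information only thanks to this bound: the rate at s is at most
   the slope of a desingularizing function over [s / 2, s]. *)
Lemma KL_rate_finite_integral (t : R) : 0 <= t -> (t%:E < eta)%E ->
  (\int[lebesgue_measure]_(s in `]0%R, t[) rho s \is a fin_num)%E.
Proof.
move=> t0 te; rewrite ge0_fin_numE; last first.
  by apply: integral_ge0 => s _; exact: KL_rate_ge0.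
have [->|t0'] := eqVneq t 0; first by rewrite set_itvoo0 integral_set0.
have {t0'} tgt0 : 0 < t by rewrite lt_def t0' t0.
have [_ [psi [dpsi Hpsi]]] := KL.
apply: (@integral_finite R _ _ _ psi) => //.
- exact: KL_rate_ge0.
- by move=> ? ?; exact: KL_rate_nincr.
- move=> s s0 st; apply: (desing_ge0 dpsi).
  by apply: (co_intervalW (t := t)) => //; exact: ltW.
move=> s s0 st.
have Iq : 0 <= (psi s - psi (s / 2)) / (s / 2).
  apply: divr_ge0; last lra.
  rewrite subr_ge0; apply/ltW/(desing_increasing dpsi).
  - by apply: (co_intervalW (t := t)) => //; lra.
  - by apply: (co_intervalW (t := t)) => //; lra.
  - lra.
apply: ge_ereal_sup => _ [->|[x [Ux /andP[sx xe]] <-]]; first by rewrite lee_fin.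
have Fpos : (0 < F x - mu%:E)%E by apply: lt_le_trans sx; rewrite lte_fin.
have := Hpsi x Ux; rewrite Fpos xe => /(_ isT).
have Ffin : (F x - mu%:E)%E \is a fin_num.
  by rewrite ge0_fin_numE ?(ltW Fpos) // (lt_le_trans xe) // leey.
have Hd := left_derive_le dpsi s0 _ _.
have {Hd} : left_derive psi (fine (F x - mu%:E)) <= (psi s - psi (s / 2)) / (s / 2).
  apply: Hd; first by rewrite -lee_fin fineK.
  by rewrite fineK.
set l := left_derive _ _; set q := _ / (s / 2) => lq.
have := setdist_ge0 0 (limiting_subdiff F x).
case: (setdist 0 _) => [d d0|_ _|//]; last by rewrite invey lee_fin.
rewrite -EFinM lee_fin => ld.
have dpos : 0 < d.
  rewrite lt_def -lee_fin d0 andbT; apply/eqP => d00; move: ld.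
  by rewrite d00 mulr0 ler10.
rewrite inver gt_eqF // lee_fin; apply: le_trans lq.
by rewrite -[d^-1]mul1r ler_pdivrMr.
Qed.

Lemma exact_modulus0 : G 0 = 0.
Proof. by rewrite /exact_modulus set_itvoo0 integral_set0. Qed.

Lemma exact_modulus_increment (a b k : R) : 0 <= a -> a <= b -> (b%:E < eta)%E ->
  0 <= k -> (forall s, s < b -> (k%:E <= rho s)%E) -> k * (b - a) <= G b - G a.
Proof.
move=> a0 ab be k0 kr.
have fb := KL_rate_finite_integral (le_trans a0 ab) be.
have fa : (\int[lebesgue_measure]_(s in `]0%R, a[) rho s \is a fin_num)%E.
  by apply: KL_rate_finite_integral => //; apply: le_lt_trans be; rewrite lee_fin.
have := integral_increment (KL_rate_ge0 _) (@KL_rate_nincr _) a0 ab k0 kr.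
by rewrite -(fineK fa) -(fineK fb) -EFinD lee_fin lerBrDl.
Qed.

Lemma exact_modulus_le (a b : R) : 0 <= a -> a <= b -> (b%:E < eta)%E -> G a <= G b.
Proof.
move=> a0 ab be; rewrite -subr_ge0.
have := exact_modulus_increment a0 ab be (lexx 0) (fun s _ => KL_rate_ge0 _ s).
by rewrite mul0r.
Qed.

Lemma KL_rate_ge z v (e : R) : U z -> F z = (mu + e)%:E -> 0 < e -> (e%:E < eta)%E ->
  limiting_subdiff F z v -> 0 < enorm v /\
  forall s, s <= e -> ((enorm v)^-1%:E <= rho s)%E.
Proof.
move=> Uz Fz e0 ee vz.
have Fe : (F z - mu%:E = e%:E)%E by rewrite Fz -EFinB addrC addKr.
have [_ [psi [dpsi Hpsi]]] := KL.
have := Hpsi z Uz; rewrite Fe lte_fin e0 ee => /(_ isT).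
have R0 s : s <= e -> ((setdist 0 (limiting_subdiff F z))^-1 <= rho s)%E.
  move=> se; apply: ereal_sup_ubound; right; exists z => //; split => //.
  by rewrite Fe lee_fin se.
move: R0; have := setdist0_le vz; have := setdist_ge0 0 (limiting_subdiff F z).
case: (setdist 0 _) => [d|//|//]; rewrite !lee_fin => d0 dv R0 ld.
have dpos : 0 < d.
  rewrite lt_def d0 andbT; apply/eqP => d00; move: ld.
  by rewrite d00 mulr0 ler10.
have vpos := lt_le_trans dpos dv; split => // s se.
apply: le_trans (R0 s se); rewrite inver gt_eqF // lee_fin lef_pV2 //.
Qed.

(** The exact modulus is used like a concave function whose derivative at height e
   is at least the inverse slope 1 / |v|. The interval [a, b] may lie strictly
   below e, which lets one point serve for a whole range of smaller heights. *)
Lemma exact_modulus_gain z v (a b e : R) : U z -> F z = (mu + e)%:E -> (e%:E < eta)%E ->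
  limiting_subdiff F z v -> 0 <= a -> a <= b -> b <= e ->
  b - a <= enorm v * (G b - G a).
Proof.
move=> Uz Fz ee vz a0 ab be.
have [e0|e0] := ltP 0 e; last first.
  have -> : a = 0 by lra.
  have -> : b = 0 by lra.
  by rewrite !subrr mulr0.
have [vpos rv] := KL_rate_ge Uz Fz e0 ee vz.
rewrite -ler_pdivrMl //; apply: exact_modulus_increment => //.
- by apply: le_lt_trans ee; rewrite lee_fin.
- by rewrite invr_ge0 ltW.
- by move=> s sb; apply: rv; apply: le_trans be; exact: ltW.
Qed.

End KLmodulus.

(** * Regular subgradients of the merit function *)

Section Subdiff.
Context {R : realType} {n : nat}.
Implicit Types (F : 'rV[R]_n -> \bar R) (x y v : 'rV[R]_n).

Lemma near_enormP x (P : 'rV[R]_n -> Prop) :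
  (\forall y \near x, P y) <->
  exists2 d : R, 0 < d & forall y, enorm (y - x) < d -> P y.
Proof.
split=> [/nbhs_ballP[d d0 H]|[d d0 H]].
  exists d => // y yx; apply: H; rewrite -ball_normE /ball_ /= distrC.
  exact: le_lt_trans (norm_le_enorm _) yx.
by apply: filterS (nbhs_enorm x d0).
Qed.

Lemma regular_subdiffP F x v : regular_subdiff F x v <->
  F x \is a fin_num /\ forall e : R, 0 < e -> exists2 d : R, 0 < d &
    forall y, enorm (y - x) < d ->
      (F x + (dot v (y - x) - e * enorm (y - x))%:E <= F y)%E.
Proof.
by split=> -[Fx H]; split=> // e e0; have := H e e0; [move/near_enormP|move=> ?; apply/near_enormP].
Qed.

Lemma regular_limiting F x v : regular_subdiff F x v -> limiting_subdiff F x v.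
Proof.
move=> vF; split; first by case: vF.
exists (fun=> x), (fun=> v); split => //; exact: cvg_cst.
Qed.

End Subdiff.

Section BregExpansion.
Context {R : realType} {n : nat}.
Implicit Types (psi : 'rV[R]_n -> R) (p q x y : 'rV[R]_n).

Lemma dot_mulmx_tr (A : 'M[R]_n) x y : dot (x *m A) y = dot x (y *m A^T).
Proof.
have E u v : dot u v = (u *m v^T) ord0 ord0.
  by rewrite mxE; apply: eq_bigr => i _; rewrite mxE.
by rewrite !E trmx_mul trmxK mulmxA.
Qed.

(** The last group of terms is of second order in (x - p, y - q), and the third
   summand is linear in y - q up to the variation of the Hessian. *)
Lemma breg_expansion psi p q x y :
  breg psi x y = breg psi p q + dot (grad psi p - grad psi q) (x - p)
    - dot (grad psi y - grad psi q) (p - q)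
    + (breg psi x p - breg psi y q - dot (grad psi y - grad psi q) ((x - p) - (y - q))).
Proof. by rewrite /breg !(dotBl, dotBr); ring. Qed.

(** In its second argument a Bregman distance is differentiable because the
   gradient is; the derivative at (p, q) is the Hessian at q applied to q - p. *)
Lemma breg_lower_expansion psi rho K p q : twice_C psi -> 0 <= K ->
  hessian_le psi (rho + 1) K -> enorm p <= rho -> enorm q <= rho ->
  exists2 A, enorm A <= K * enorm (p - q) & forall e : R, 0 < e ->
    exists2 d : R, 0 < d & forall x y, enorm (x - p) < d -> enorm (y - q) < d ->
      breg psi p q + dot (grad psi p - grad psi q) (x - p) + dot A (y - q)
        - e * (enorm (x - p) + enorm (y - q)) <= breg psi x y.
Proof.
move=> C2psi K0 HK pr qr; have [_ dg cH] := C2psi.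
have r1 (z : 'rV[R]_n) : enorm z <= rho -> enorm z <= rho + 1 by move/le_trans; apply; rewrite lerDl.
exists ((q - p) *m (hessian psi q)^T).
  set A := _ *m _; have H := HK q A (q - p) (r1 _ qr).
  have [->|A0] := eqVneq (enorm A) 0; first by rewrite mulr_ge0 ?enorm_ge0.
  have Agt0 : 0 < enorm A by rewrite lt_def A0 enorm_ge0.
  rewrite -(ler_pM2r Agt0) -expr2 enorm_sq {2}/A -dot_mulmx_tr.
  apply: le_trans (ler_norm _) _; apply: le_trans H _.
  by rewrite (enormB q p) le_eqVlt; apply/orP; left; apply/eqP; ring.
move=> e e0.
have n2 : 0 <= n%:R ^+ 2 :> R by rewrite sqr_ge0.
pose u := enorm (p - q).
have u0 : 0 <= u by exact: enorm_ge0.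
(* The Hessian varies by less than e1 near q. *)
pose e1 : R := e / (2 * (n%:R ^+ 2 * u + 1)).
have den0 : 0 < n%:R ^+ 2 * u + 1 :> R by rewrite ltr_wpDl // mulr_ge0.
have e10 : 0 < e1 by rewrite divr_gt0 // mulr_gt0.
have /near_enormP[d1 d10 Hd1] : \forall z \near q, `|hessian psi q - hessian psi z| <= e1.
  by have /cvgrPdist_le := cH q; exact.
pose d2 : R := e / (8 * (K + 1)).
have K1 : 0 < K + 1 by rewrite ltr_wpDl.
have d20 : 0 < d2 by rewrite divr_gt0 // mulr_gt0.
exists (Num.min 1 (Num.min d1 d2)); first by rewrite !lt_min ltr01 d10 d20.
move=> x y; rewrite !lt_min => /and3P[x1 xd1 xd2] /and3P[y1 yd1 yd2].
have ball1 (a z : 'rV[R]_n) : enorm a <= rho -> enorm (z - a) < 1 -> enorm z <= rho + 1.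
  move=> ar za; have := enorm_dist a z 0; rewrite !subr0 => H.
  by apply: le_trans H _; rewrite addrC lerD // ltW.
have xr := ball1 _ _ pr x1; have yr := ball1 _ _ qr y1.
rewrite (breg_expansion psi p q x y).
set r := enorm (x - p) in xd2 *; set s := enorm (y - q) in yd1 yd2 *.
have rge0 : 0 <= r by exact: enorm_ge0.
have sge0 : 0 <= s by exact: enorm_ge0.
have B1 := breg_le C2psi HK xr (r1 _ pr).
have B2 := breg_le C2psi HK yr (r1 _ qr).
have B3 := grad_lipschitz C2psi HK yr (r1 _ qr).
have B4 : dot (grad psi y - grad psi q) (x - p - (y - q)) <= K * s * (r + s).
  apply: le_trans (dot_le _ _) _; apply: ler_pM; rewrite ?enorm_ge0 //.
  by apply: le_trans (enormD _ _) _; rewrite enormN.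
have B5 : `|dot (grad psi y - grad psi q) (p - q) - dot ((y - q) *m hessian psi q) (p - q)|
    <= e / 2 * s.
  have [t t01 ->] := grad_MVT y q (p - q) dg.
  rewrite -dotBl -mulmxBr; apply: le_trans (quad_form_le _ _ _) _.
  have Hz : `|hessian psi (q + t *: (y - q)) - hessian psi q| <= e1.
    rewrite distrC; apply: Hd1; rewrite addrC addKr enormZ.
    have /andP[t0 t1] := t01; rewrite ger0_norm //.
    by apply: le_lt_trans yd1; rewrite ler_piMl.
  apply: (@le_trans _ _ (n%:R ^+ 2 * e1 * s * u)).
    by do 2 (rewrite ler_wpM2r ?enorm_ge0 //); rewrite ler_wpM2l.
  have -> : n%:R ^+ 2 * e1 * s * u = (n%:R ^+ 2 * u) * e1 * s by ring.
  rewrite ler_wpM2r // /e1 mulrA ler_pdivrMr ?mulr_gt0 //.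
  have -> : e / 2 * (2 * (n%:R ^+ 2 * u + 1)) = e * (n%:R ^+ 2 * u + 1) by field.
  by rewrite mulrC ler_wpM2l ?(ltW e0) // lerDl.
have -> : dot ((q - p) *m (hessian psi q)^T) (y - q)
    = - dot ((y - q) *m hessian psi q) (p - q).
  by rewrite dotC dot_mulmx_tr -dotNr -mulNmx opprB.
have S1 : K * r ^+ 2 + K * s ^+ 2 + K * s * (r + s) <= e / 2 * (r + s).
  apply: (@le_trans _ _ (2 * K * (r + s) ^+ 2)).
    rewrite -subr_ge0.
    have -> : 2 * K * (r + s) ^+ 2 - (K * r ^+ 2 + K * s ^+ 2 + K * s * (r + s))
       = K * (r ^+ 2 + 3 * (r * s)) by ring.
    by rewrite mulr_ge0 // addr_ge0 ?sqr_ge0 // !mulr_ge0.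
  rewrite expr2 mulrA ler_wpM2r ?addr_ge0 //.
  apply: (@le_trans _ _ (2 * K * (2 * d2))).
    by rewrite ler_wpM2l ?mulr_ge0 //; lra.
  have -> : 2 * K * (2 * d2) = K / (K + 1) * (e / 2).
    by rewrite /d2; field; rewrite gt_eqF.
  rewrite ler_piMl //; first by rewrite divr_ge0 // ltW.
  by rewrite ler_pdivrMr // mul1r lerDl.
move: B1 B2 B5; rewrite !ler_norml -/r -/s => /andP[B1 _] /andP[_ B2] /andP[_ B5].
have er := mulr_ge0 (ltW e0) rge0; have es := mulr_ge0 (ltW e0) sge0.
lra.
Qed.

End BregExpansion.

Lemma mul_le_4sq (R : realType) (a b s : R) :
  0 <= a -> 0 <= b -> a <= 2 * s -> b <= 2 * s -> a * b <= 4 * s ^+ 2.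
Proof. by move=> a0 b0 as2 bs; have := ler_pM a0 b0 as2 bs; rewrite expr2; lra. Qed.

Section Merit.
Context {R : realType} {n : nat}.
Variables (phi : 'rV[R]_n -> \bar R) (hh fh hr xr : 'rV[R]_n -> R) (c1 : R).
Implicit Types (p q w x y v : 'rV[R]_n) (z : 'rV[R]_(n + (n + n))).

Definition model_gap w x y : R :=
  breg hh w x + dot (w - x) (grad fh x - grad fh y).

Definition merit_gap w x y : R :=
  model_gap w x y + (c1 * breg hr x y + breg xr x y).

(** The merit function once h, f and xi are known to be finite: an extended-valued
   part depending on the first block only, plus a smooth real-valued gap. *)
Definition real_merit z : \bar R :=
  (phi (lsubmx z)
   + (merit_gap (lsubmx z) (lsubmx (rsubmx z)) (rsubmx (rsubmx z)))%:E)%E.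

Lemma real_merit_triple w x y :
  real_merit (triple w x y) = (phi w + (merit_gap w x y)%:E)%E.
Proof. by rewrite /real_merit /triple !(row_mxKl, row_mxKr). Qed.

Lemma breg_id (psi : 'rV[R]_n -> R) y : breg psi y y = 0.
Proof. by rewrite /breg !subrr dot0r subr0. Qed.

Lemma model_gap_id w y : model_gap w w y = 0.
Proof. by rewrite /model_gap breg_id subrr dot0l addr0. Qed.

Lemma tripleP z : exists w x y, z = triple w x y.
Proof.
exists (lsubmx z), (lsubmx (rsubmx z)), (rsubmx (rsubmx z)).
by rewrite /triple !hsubmxK.
Qed.

Lemma tripleB w x y p q v :
  triple w x y - triple p q v = triple (w - p) (x - q) (y - v).
Proof. by rewrite /triple !opp_row_mx !add_row_mx. Qed.

Lemma dot_triple w x y p q v :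
  dot (triple w x y) (triple p q v) = dot w p + dot x q + dot y v.
Proof. by rewrite /triple !dot_row_mx addrA. Qed.

Lemma enorm_triple w x y : enorm (triple w x y) <= enorm w + enorm x + enorm y.
Proof.
apply: le_trans (enorm_row_mx _ _) _; rewrite -addrA lerD2l.
exact: enorm_row_mx.
Qed.

Lemma triple_enorm w x y (s := enorm (triple w x y)) :
  [/\ enorm w <= s, enorm x <= s & enorm y <= s].
Proof.
split; first exact: enorm_row_mxl.
  by apply: le_trans (enorm_row_mxr _ _); exact: enorm_row_mxl.
by apply: le_trans (enorm_row_mxr _ _); exact: enorm_row_mxr.
Qed.

End Merit.

(** The Hessians are controlled on a ball larger by 1 than the one containing the
   points of interest, to leave room for the neighbourhoods on which regular
   subgradients are tested. *)
Record smooth_data (R : realType) (n : nat) (hh fh hr xr : 'rV[R]_n -> R)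
    (c1 rho K : R) : Prop := SmoothData {
  _ : twice_C hh; _ : twice_C fh; _ : twice_C hr; _ : twice_C xr;
  _ : 0 < K; _ : 0 < c1;
  _ : hessian_le hh (rho + 1) K; _ : hessian_le fh (rho + 1) K;
  _ : hessian_le hr (rho + 1) K; _ : hessian_le xr (rho + 1) K
}.

Lemma near_ball (R : realType) (n : nat) (rho : R) (a w : 'rV[R]_n) :
  enorm a <= rho -> enorm (w - a) < 1 -> enorm w <= rho + 1.
Proof.
move=> ar wa; have := enorm_dist a w 0; rewrite !subr0 => H.
by apply: le_trans H _; rewrite addrC lerD // ltW.
Qed.

Lemma model_gap_le (R : realType) (n : nat) (hh fh : 'rV[R]_n -> R) (rho K : R) :
  twice_C hh -> twice_C fh ->
  hessian_le hh (rho + 1) K -> hessian_le fh (rho + 1) K ->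
  forall w x y, enorm w <= rho + 1 -> enorm x <= rho + 1 ->
  enorm y <= rho + 1 ->
  `|model_gap hh fh w x y| <= K * enorm (w - x) ^+ 2 + K * (enorm (w - x) * enorm (x - y)).
Proof.
move=> C2hh C2fh Khh Kfh w x y wr xr' yr.
apply: le_trans (ler_normD _ _) _; apply: lerD.
  exact: (breg_le C2hh Khh wr xr').
apply: le_trans (CauchySchwarz _ _) _; rewrite mulrCA ler_wpM2l ?enorm_ge0 //.
exact: (grad_lipschitz C2fh Kfh xr' yr).
Qed.

Lemma merit_gap_le (R : realType) (n : nat) (hh fh hr xr : 'rV[R]_n -> R)
    (c1 rho K : R) : smooth_data hh fh hr xr c1 rho K ->
  forall w x y, enorm w <= rho + 1 -> enorm x <= rho + 1 ->
  enorm y <= rho + 1 ->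
  `|merit_gap hh fh hr xr c1 w x y| <= K * enorm (w - x) ^+ 2 + K * (enorm (w - x) * enorm (x - y))
     + (c1 + 1) * K * enorm (x - y) ^+ 2.
Proof.
move=> [C2hh C2fh C2hr C2xr K0 c10 Khh Kfh Khr Kxr] w x y wr xr' yr.
apply: le_trans (ler_normD _ _) _; apply: lerD.
  exact: (model_gap_le C2hh C2fh Khh Kfh).
apply: le_trans (ler_normD _ _) _.
rewrite normrM (gtr0_norm c10) -[leRHS]mulrA mulrDl mul1r; apply: lerD.
  by rewrite ler_pM2l // (breg_le C2hr Khr).
exact: (breg_le C2xr Kxr xr' yr).
Qed.

(** Near the diagonal the gap is quadratic, so that only the subgradients of phi
   contribute there. *)
Lemma merit_subdiff_diag (R : realType) (n : nat) (phi : 'rV[R]_n -> \bar R) (hh fh hr xr : 'rV[R]_n -> R)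
    (c1 rho K : R) : smooth_data hh fh hr xr c1 rho K ->
  forall p v, enorm p <= rho -> regular_subdiff phi p v ->
  regular_subdiff (real_merit phi hh fh hr xr c1) (triple p p p) (triple v 0 0).
Proof.
move=> sm p v pr /regular_subdiffP[pfin Hv]; have [_ _ _ _ K0 c10 _ _ _ _] := sm; apply/regular_subdiffP; split.
  by rewrite real_merit_triple fin_numD pfin.
move=> e e0; have e2 : 0 < e / 2 by rewrite divr_gt0.
have [d d0 Hd] := Hv _ e2.
have c30 : 0 < c1 + 3 by rewrite addr_gt0.
pose d' := e / (8 * (K * (c1 + 3))).
have den0 : 0 < 8 * (K * (c1 + 3)) by rewrite mulr_gt0 // mulr_gt0.
have d'0 : 0 < d' by rewrite divr_gt0.
exists (Num.min 1 (Num.min d d')); first by rewrite !lt_min ltr01 d0 d'0.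
move=> z; have [w [x [y ->]]] := tripleP z.
rewrite !real_merit_triple tripleB dot_triple !dot0l !addr0.
rewrite !lt_min => /and3P[].
have [] := triple_enorm (w - p) (x - p) (y - p).
set s := enorm (triple _ _ _) => ws xs ys s1 sd sd'.
have s0 : 0 <= s by exact: enorm_ge0.
have wr := near_ball pr (le_lt_trans ws s1).
have xr' := near_ball pr (le_lt_trans xs s1).
have yr := near_ball pr (le_lt_trans ys s1).
have wx : enorm (w - x) <= 2 * s.
  by have := enorm_dist p w x; rewrite (enormB p x); move: ws xs; clear; lra.
have xy : enorm (x - y) <= 2 * s.
  by have := enorm_dist p x y; rewrite (enormB p y); move: xs ys; clear; lra.
have := Hd w (le_lt_trans ws sd).
have -> : merit_gap hh fh hr xr c1 p p p = 0 by rewrite /merit_gap model_gap_id !breg_id mulr0 !addr0.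
rewrite adde0; move/(leeD2r (merit_gap hh fh hr xr c1 w x y)%:E); apply: le_trans.
rewrite -addeA leeD2l // -EFinD lee_fin.
have := merit_gap_le sm wr xr' yr; rewrite ler_norml => /andP[Q _].
have {}Q : - (4 * (K * (c1 + 3)) * s ^+ 2) <= merit_gap hh fh hr xr c1 w x y.
  apply: le_trans Q; rewrite lerN2.
  have w0 := enorm_ge0 (w - x); have y0 := enorm_ge0 (x - y).
  have A1 : enorm (w - x) ^+ 2 <= 4 * s ^+ 2.
    by rewrite expr2; exact: mul_le_4sq.
  have A2 : enorm (w - x) * enorm (x - y) <= 4 * s ^+ 2.
    exact: mul_le_4sq.
  have A3 : enorm (x - y) ^+ 2 <= 4 * s ^+ 2.
    by rewrite expr2; exact: mul_le_4sq.
  have cK : 0 <= (c1 + 1) * K by rewrite mulr_ge0 ?addr_ge0 // ltW.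
  have := ler_wpM2l (ltW K0) A1; have := ler_wpM2l (ltW K0) A2.
  have := ler_wpM2l cK A3; clear; lra.
have : 4 * (K * (c1 + 3)) * s ^+ 2 <= e / 2 * s.
  rewrite expr2 mulrA ler_wpM2r //.
  by move: (ltW sd'); rewrite /d' ler_pdivlMr //; clear; lra.
have := ler_wpM2l (ltW e2) ws; move: Q; clear; lra.
Qed.

(** Points (p, p, q) carry subgradients of size O(|p - q|) while the merit
   exceeds phi p by the two Bregman terms, quadratic in |p - q|. *)
Lemma merit_subdiff_offdiag (R : realType) (n : nat) (phi : 'rV[R]_n -> \bar R) (hh fh hr xr : 'rV[R]_n -> R)
    (c1 rho K : R) : smooth_data hh fh hr xr c1 rho K ->
  forall p q, enorm p <= rho -> enorm q <= rho ->
  regular_subdiff phi p 0 ->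
  exists2 V, regular_subdiff (real_merit phi hh fh hr xr c1) (triple p p q) V
    & enorm V <= (2 * c1 + 4) * K * enorm (p - q).
Proof.
move=> [C2hh C2fh C2hr C2xr K0 c10 Khh Kfh Khr Kxr] p q pr qr.
move=> /regular_subdiffP[pfin H0].
have r1 (w : 'rV[R]_n) : enorm w <= rho -> enorm w <= rho + 1.
  by move/le_trans; apply; rewrite lerDl.
have [Ah Ahle EAh] := breg_lower_expansion C2hr (ltW K0) Khr pr qr.
have [Ax Axle EAx] := breg_lower_expansion C2xr (ltW K0) Kxr pr qr.
set u := enorm (p - q) in Ahle Axle *.
pose G := grad fh p - grad fh q.
pose Gh := grad hr p - grad hr q; pose Gx := grad xr p - grad xr q.
have Gle : enorm G <= K * u := grad_lipschitz C2fh Kfh (r1 _ pr) (r1 _ qr).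
have Ghle : enorm Gh <= K * u := grad_lipschitz C2hr Khr (r1 _ pr) (r1 _ qr).
have Gxle : enorm Gx <= K * u := grad_lipschitz C2xr Kxr (r1 _ pr) (r1 _ qr).
exists (triple G (- G + (c1 *: Gh + Gx)) (c1 *: Ah + Ax)); last first.
  have comb (a b : 'rV[R]_n) : enorm a <= K * u -> enorm b <= K * u ->
      enorm (c1 *: a + b) <= c1 * (K * u) + K * u.
    move=> au bu; apply: le_trans (enormD _ _) _; apply: lerD => //.
    by rewrite enormZ (gtr0_norm c10) ler_pM2l.
  have -> : (2 * c1 + 4) * K * u
      = K * u + (K * u + (c1 * (K * u) + K * u)) + (c1 * (K * u) + K * u) by ring.
  apply: le_trans (enorm_triple _ _ _) _; apply: lerD; last exact: comb.
  apply: lerD; first exact: Gle.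
  apply: le_trans (enormD _ _) _; rewrite (enormN G).
  by apply: lerD; [exact: Gle|exact: comb].
apply/regular_subdiffP; split.
  by rewrite real_merit_triple fin_numD pfin.
move=> e e0; have e2 : 0 < e / 2 by rewrite divr_gt0.
have [d d0 Hd] := H0 _ e2.
have c11 : 0 < c1 + 1 by rewrite addr_gt0.
pose e1 := e / (8 * (c1 + 1)).
have e10 : 0 < e1 by rewrite divr_gt0 // mulr_gt0.
have [dh dh0 Hh] := EAh _ e10; have [dx dx0 Hx] := EAx _ e10.
pose d' := e / (32 * K).
have d'0 : 0 < d' by rewrite divr_gt0 // mulr_gt0.
exists (Num.min 1 (Num.min d (Num.min dh (Num.min dx d')))).
  by rewrite !lt_min ltr01 d0 dh0 dx0 d'0.
move=> z; have [w [x [y ->]]] := tripleP z.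
rewrite !real_merit_triple tripleB dot_triple.
rewrite !lt_min => /and5P[].
have [] := triple_enorm (w - p) (x - p) (y - q).
set s := enorm (triple _ _ _) => ws xs ys s1 sd sdh sdx sd'.
have s0 : 0 <= s by exact: enorm_ge0.
have wr := near_ball pr (le_lt_trans ws s1).
have xr' := near_ball pr (le_lt_trans xs s1).
have yr := near_ball qr (le_lt_trans ys s1).
have wx : enorm (w - x) <= 2 * s.
  by have := enorm_dist p w x; rewrite (enormB p x); move: ws xs; clear; lra.
have {Hd} := Hd w (le_lt_trans ws sd); rewrite dot0l sub0r.
move/(leeD2r (merit_gap hh fh hr xr c1 w x y)%:E); apply: le_trans.
rewrite -!addeA leeD2l // -!EFinD lee_fin.
have -> : merit_gap hh fh hr xr c1 p p q = c1 * breg hr p q + breg xr p q.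
  by rewrite /merit_gap model_gap_id add0r.
rewrite /merit_gap /model_gap.
have {}Hh := Hh x y (le_lt_trans xs sdh) (le_lt_trans ys sdh).
have {}Hx := Hx x y (le_lt_trans xs sdx) (le_lt_trans ys sdx).
rewrite -/Gh in Hh; rewrite -/Gx in Hx.
have {}Hh := ler_wpM2l (ltW c10) Hh.
have B1 : - (4 * K * s ^+ 2) <= breg hh w x.
  have := breg_le C2hh Khh wr xr'; rewrite ler_norml => /andP[B _].
  apply: le_trans B; rewrite lerN2.
  have w0 := enorm_ge0 (w - x).
  have A1 : enorm (w - x) ^+ 2 <= 4 * s ^+ 2.
    by rewrite expr2; exact: mul_le_4sq.
  have := ler_wpM2l (ltW K0) A1; clear; lra.
have B2 : dot G (w - p) - dot G (x - p) - 4 * K * s ^+ 2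
    <= dot (w - x) (grad fh x - grad fh y).
  have -> : grad fh x - grad fh y = G + ((grad fh x - grad fh p) + (grad fh q - grad fh y)).
    rewrite /G; apply/rowP => i; rewrite !mxE; ring.
  rewrite -dotBr [leRHS]dotDr (_ : w - p - (x - p) = w - x); last first.
    by apply/rowP => i; rewrite !mxE; ring.
  rewrite (dotC G) lerD2l; apply: le_trans (dot_ge _ _); rewrite lerN2.
  have gl : enorm (grad fh x - grad fh p + (grad fh q - grad fh y)) <= 2 * K * s.
    apply: le_trans (enormD _ _) _.
    have h1 := grad_lipschitz C2fh Kfh xr' (r1 _ pr).
    have h2 := grad_lipschitz C2fh Kfh (r1 _ qr) yr.
    rewrite enormB in h2; rewrite (enormB q y) in h2; rewrite enormB.
    have := ler_wpM2l (ltW K0) xs; have := ler_wpM2l (ltW K0) ys.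
    rewrite (enormB (grad fh q)) in h2 *; rewrite (enormB (grad fh p)).
    by move: h1 h2; clear; lra.
  have := ler_pM (enorm_ge0 _) (enorm_ge0 _) wx gl; clear; lra.
have S1 : 8 * K * s ^+ 2 <= e / 4 * s.
  rewrite expr2 mulrA ler_wpM2r //.
  by move: (ltW sd'); rewrite /d' ler_pdivlMr ?mulr_gt0 //; clear; lra.
have S2 : (c1 + 1) * (e1 * (2 * s)) = e / 4 * s.
  by rewrite /e1; field; rewrite gt_eqF.
have S3 := ler_wpM2l (ltW e2) ws.
have S4 : e1 * (enorm (x - p) + enorm (y - q)) <= e1 * (2 * s).
  by rewrite ler_pM2l //; move: xs ys; clear; lra.
have S5 := ler_wpM2l (ltW c10) S4.
rewrite (dotDl (- G)) (dotNl G) (dotDl (c1 *: Gh)) (dotZl c1 Gh) (dotDl (c1 *: Ah)).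
rewrite (dotZl c1 Ah); move: B1 B2 S1 S2 S3 S4 S5 Hh Hx.
move: (breg hh w x) (dot (w - x) _) (breg hr x y) (breg xr x y) => b1 b2 b3 b4.
move: (dot G (w - p)) (dot G (x - p)) (dot Gh (x - p)) (dot Gx (x - p)) => d1 d2 d3 d4.
move: (dot Ah _) (dot Ax _) (breg hr p q) (breg xr p q) => d5 d6 d7 d8.
move: (enorm (x - p) + _) (enorm (w - p)) => t1 t2.
clear => B1 B2 S1 S2 S3 S4 S5 Hh Hx.
lra.
Qed.

(** * Strong convexity on balls *)

Lemma breg_strong (R : realType) (n : nat) (psi : 'rV[R]_n -> R) (rho s : R) :
  twice_C psi ->
  (forall x y, enorm x <= rho -> enorm y <= rho ->
    s * enorm (x - y) ^+ 2 <= dot (grad psi x - grad psi y) (x - y)) ->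
  forall x y, enorm x <= rho -> enorm y <= rho ->
    s / 2 * enorm (x - y) ^+ 2 <= breg psi x y.
Proof.
move=> C2psi mono x y xr yr.
have C2h := @twice_C_half_sq R n.
have C2 := twice_C_lincomb 1 (- s) C2psi C2h.
suff : 0 <= breg (lincomb 1 (- s) psi half_sq) x y.
  by rewrite breg_lincomb // breg_half_sq mul1r mulNr subr_ge0 mulrCA mulrC mulrA.
have [d _ _] := C2; have [d1 _ _] := C2psi; have [d2 _ _] := C2h.
have [t t01 E] := psi_MVT x y d; rewrite /breg E -dotBl.
have /andP[t0 t1] := t01.
have [->|tn0] := eqVneq t 0; first by rewrite scale0r addr0 subrr dot0l.
have tgt0 : 0 < t by rewrite lt_def tn0.
set z := y + _; have zE : z - y = t *: (x - y) by rewrite /z addrC addKr.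
have zr : enorm z <= rho by exact: segment_le.
clearbody z; rewrite !grad_lincomb // !grad_half_sq -(pmulr_rge0 _ tgt0) -dotZr -zE.
have := mono z y zr yr.
rewrite !scale1r !(dotBl, dotDl, dotZl) enorm_sq dotBl; lra.
Qed.

Lemma eball0E (R : realType) (n : nat) (rho : R) (x : 'rV[R]_n) :
  eball 0 rho x <-> enorm x <= rho.
Proof. by rewrite /eball /= subr0. Qed.

Lemma strongly_convex_ball (R : realType) (n : nat) (h : 'rV[R]_n -> \bar R)
    (rho s : R) : twice_C (fine \o h) ->
  (forall x y, enorm x <= rho -> enorm y <= rho ->
    s / 2 * enorm (x - y) ^+ 2 <= breg (fine \o h) x y) ->
  strongly_convex_on (eball 0 rho) s h.
Proof.
move=> C2psi str; have C2h := @twice_C_half_sq R n.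
rewrite /strongly_convex_on.
have -> : (fun x => fine (h x) - s / 2 * enorm x ^+ 2)
    = lincomb 1 (- s) (fine \o h) half_sq.
  by apply/funext => x; rewrite /lincomb /half_sq /=; field.
apply: breg_ge0_convex.
  move=> x y t /eball0E xr /eball0E yr t01; apply/eball0E.
  rewrite (_ : _ + _ = y + t *: (x - y)); first exact: segment_le.
  by rewrite scalerBr scalerBl scale1r addrCA.
move=> x y /eball0E xr /eball0E yr.
rewrite breg_lincomb // breg_half_sq mul1r mulNr subr_ge0.
by apply: le_trans (str x y xr yr); rewrite mulrA mulrAC.
Qed.

(** Midpoint convexity along a diameter bounds the modulus. *)
Lemma strong_convexity_bounded (R : realType) (n : nat) (h : 'rV[R]_n -> \bar R)
    (rho : R) (d : 'rV[R]_n) : 0 < rho -> enorm d = 1 ->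
  exists2 S, 0 < S & forall s, strongly_convex_on (eball 0 rho) s h -> s <= S.
Proof.
move=> rho0 d1; pose f x := fine (h x).
exists (`|(f (rho *: d) + f (- rho *: d) - 2 * f 0) / rho ^+ 2| + 1).
  by rewrite ltr_wpDl.
move=> s /convex_functionP H.
have dr (a : R) : `|a| = rho -> eball 0 rho (a *: d).
  by move=> ar; apply/eball0E; rewrite enormZ d1 mulr1 ar.
have h2 : 0 <= (2^-1 : R) <= 1 by lra.
have x1 : eball 0 rho (rho *: d) by apply: dr; exact: gtr0_norm.
have x2 : eball 0 rho (- rho *: d) by apply: dr; rewrite normrN gtr0_norm.
have := H _ _ _ x1 x2 h2; rewrite !scalerA -scalerDl.
rewrite (_ : 2^-1 * rho + (1 - 2^-1) * - rho = 0); last by field.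
rewrite scale0r enorm0 expr0n /= mulr0 subr0 !enormZ normrN d1 mulr1 (gtr0_norm rho0).
rewrite -/(f _) -/(f _) -/(f _) => {}H.
have r2 : 0 < rho ^+ 2 by rewrite exprn_gt0.
have : s <= (f (rho *: d) + f (- rho *: d) - 2 * f 0) / rho ^+ 2.
  by rewrite ler_pdivlMr //; lra.
move/le_trans; apply; apply: le_trans (ler_norm _) _.
by rewrite lerDl.
Qed.

(** * Summability from a telescoping estimate *)

Section RealSequences.
Context {R : realType}.

(** Write t_k = a_{k+1} + a_k. Then (A / 2) t_k^2 <= B t_k (H_k - H_{k+1}), and one
   factor t_k cancels. *)
Lemma telescoped_length (a l H : nat -> R) (A B : R) (k0 : nat) :
  0 < A -> 0 < B -> (forall k, 0 <= a k) ->
  (forall k, (k0 <= k)%N -> A * (a k.+1 ^+ 2 + a k ^+ 2) <= l k - l k.+1) ->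
  (forall k, (k0 <= k)%N -> l k - l k.+1 <= B * (a k.+1 + a k) * (H k - H k.+1)) ->
  (forall k, (k0 <= k)%N -> H k.+1 <= H k) ->
  (forall k, (k0 <= k)%N -> 0 <= H k) ->
  forall m, (k0 <= m)%N -> forall N, \sum_(m <= k < N) a k.+1 <= 2 * B / A * H m.
Proof.
move=> A0 B0 a0 HA HB Hd H0 m km N.
have C0 : 0 < 2 * B / A by rewrite divr_gt0 // mulr_gt0.
have step k : (k0 <= k)%N -> a k.+1 <= 2 * B / A * (H k - H k.+1).
  move=> kk; have := Hd k kk; rewrite -subr_ge0 => Hd0.
  have [->|ak] := eqVneq (a k.+1) 0; first by rewrite mulr_ge0 // ltW.
  have akgt : 0 < a k.+1 by rewrite lt_def ak a0.
  have sgt : 0 < a k.+1 + a k by rewrite ltr_wpDr.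
  apply: (@le_trans _ _ (a k.+1 + a k)); first by rewrite lerDl.
  have E : (A / 2) * (a k.+1 + a k) ^+ 2 <= A * (a k.+1 ^+ 2 + a k ^+ 2).
    rewrite -mulrA ler_pM2l // mulrC ler_pdivrMr // -subr_ge0.
    have -> : (a k.+1 ^+ 2 + a k ^+ 2) * 2 - (a k.+1 + a k) ^+ 2
      = (a k.+1 - a k) ^+ 2 by ring.
    exact: sqr_ge0.
  have := le_trans E (le_trans (HA k kk) (HB k kk)).
  rewrite expr2 mulrA (mulrAC B) ler_pM2r // -ler_pdivlMl ?divr_gt0 //.
  by rewrite invf_div mulrA (mulrAC 2).
have tele j : \sum_(m <= k < m + j) a k.+1 <= 2 * B / A * (H m - H (m + j)%N).
  elim: j => [|j IH]; first by rewrite addn0 big_geq // subrr mulr0.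
  rewrite addnS big_nat_recr ?leq_addr //=.
  have := step (m + j)%N (leq_trans km (leq_addr _ _)); move: IH.
  rewrite !mulrBr; lra.
have Hm := H0 m km; have [Nm|mN] := leqP N m.
  by rewrite big_geq // mulr_ge0 // ltW.
have := tele (N - m)%N; rewrite subnKC; last exact: ltnW.
move/le_trans; apply; rewrite ler_pM2l // gerBl; apply: H0.
exact: leq_trans km (ltnW mN).
Qed.

Lemma series_tail_bound (u : nat -> R) (C : R) (m : nat) :
  (forall k, 0 <= u k) -> (forall N, \sum_(m <= k < N) u k <= C) ->
  cvgn (series u) /\ limn (series u) <= \sum_(0 <= k < m) u k + C.
Proof.
move=> u0 uC.
have bnd N : series u N <= \sum_(0 <= k < m) u k + C.
  rewrite /series /=; have [Nm|mN] := leqP N m.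
    apply: (@le_trans _ _ (\sum_(0 <= k < m) u k)).
      rewrite [leRHS](big_cat_nat (n := N)) //= lerDl.
      exact: sumr_ge0.
    rewrite lerDl; apply: le_trans (uC m).
    by rewrite big_geq.
  by rewrite (big_cat_nat (n := m)) //= ?lerD2l // ltnW.
have cv : cvgn (series u).
  apply: nondecreasing_is_cvgn; first by apply: nondecreasing_series => k _ _.
  by exists (\sum_(0 <= k < m) u k + C) => _ [N _ <-].
split => //; apply: limr_le => //; exact: nearW.
Qed.

End RealSequences.

(** * Descent along the iteration *)

(** What the convergence proof needs from either kind of admissible parameters. The
   inequality md_gap is the sufficient decrease in terms of the model alone; it
   involves a coefficient cp that may be smaller than the coefficient c1 of D_h in
   the merit function. *)
Record merit_descent (R : realType) (n : nat) (phi : 'rV[R]_n -> \bar R)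
    (hh fh hr xr : 'rV[R]_n -> R) (c1 cp : R) (x : nat -> 'rV[R]_n)
    (xm1 : 'rV[R]_n) : Prop := MeritDescent {
  md_hh : twice_C hh;
  md_fh : twice_C fh;
  md_hr : twice_C hr;
  md_xr : twice_C xr;
  md_posdef : forall z, posdef (hessian hr z);
  md_cp : 0 < cp;
  md_c1 : cp <= c1;
  md_proper : proper_fun phi;
  md_lsc : lower_semicontinuous phi;
  md_level : level_bounded phi;
  md_bounded : exists m : R, forall w, (m%:E <= phi w)%E;
  md_xi : forall w y, 0 <= breg xr w y;
  md_gap : forall w z y,
    2 * cp * breg hr w z + breg xr w z <= model_gap hh fh w z y + breg xr z y;
  md_step : forall k w,
    (phi (x k.+1) + (model_gap hh fh (x k.+1) (x k) (previous xm1 x k))%:E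
      <= phi w + (model_gap hh fh w (x k) (previous xm1 x k))%:E)%E
}.

Section Descent.
Variables (R : realType) (n : nat) (phi : 'rV[R]_n -> \bar R)
  (hh fh hr xr : 'rV[R]_n -> R) (c1 cp : R) (x : nat -> 'rV[R]_n) (xm1 : 'rV[R]_n).
Hypothesis md : merit_descent phi hh fh hr xr c1 cp x xm1.

Local Notation prev k := (previous xm1 x k).
Definition value k : R := fine (phi (x k.+1)).
(** The Lyapunov value at (x_k, x_{k-1}) with c as the coefficient of D_h. *)
Definition lyap c k : R :=
  value k + merit_gap hh fh hr xr c (x k.+1) (x k) (prev k).
Definition jump k : R := enorm (x k - prev k).

Lemma value_fin k : phi (x k.+1) = (value k)%:E.
Proof.
have [pNy [w pw]] := md_proper md.
have fw : phi w \is a fin_num by rewrite fin_numElt pNy.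
have := md_step md k w; rewrite /value; have := pNy (x k.+1).
by case: (phi (x k.+1)) => [r|_|//]; rewrite // -(fineK fw) -EFinD addye.
Qed.

Lemma breg_hr_ge0 w y : 0 <= breg hr w y.
Proof.
pose rho := Num.max (enorm w) (enorm y).
have [s s0 Hs] := grad_strongly_monotone (md_hr md) (md_posdef md) rho.
have wr : enorm w <= rho by rewrite le_max lexx.
have yr : enorm y <= rho by rewrite le_max lexx orbT.
apply: le_trans (breg_strong (md_hr md) Hs wr yr).
by rewrite mulr_ge0 ?sqr_ge0 // divr_ge0 // ltW.
Qed.

(** The envelope at (x_{k+1}, x_k) is at most the model evaluated at w = x_{k+1},
   which is phi(x_{k+1}); md_gap then pays for both Bregman distances. *)
Lemma lyap_decrease k :
  lyap cp k.+1 + cp * (breg hr (x k.+1) (x k) + breg hr (x k) (prev k)) <= lyap cp k.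
Proof.
have := md_step md k.+1 (x k.+1).
rewrite !value_fin -!EFinD lee_fin model_gap_id addr0 /= => S.
have := md_gap md (x k.+1) (x k) (prev k).
rewrite /lyap /merit_gap /=; move: S.
move: (value k.+1) (value k) (model_gap _ _ (x k.+2) _ _).
move: (model_gap _ _ (x k.+1) (x k) _) (breg hr (x k.+1) _) (breg hr (x k) _).
by move: (breg xr (x k.+1) _) (breg xr (x k) _) => *; lra.
Qed.

Lemma value_le_lyap k : value k <= lyap cp k.
Proof.
rewrite /lyap lerDl /merit_gap.
have := md_gap md (x k.+1) (x k) (prev k).
have h1 := mulr_ge0 (ltW (md_cp md)) (breg_hr_ge0 (x k.+1) (x k)).
have h2 := mulr_ge0 (ltW (md_cp md)) (breg_hr_ge0 (x k) (prev k)).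
have h3 := md_xi md (x k.+1) (x k).
move: h1 h2 h3; move: (breg hr (x k.+1) _) (breg hr (x k) _) (breg xr (x k.+1) _).
by move: (breg xr (x k) _) (model_gap _ _ _ _ _) => *; lra.
Qed.

Lemma lyap_le k : lyap cp k <= lyap c1 k.
Proof.
rewrite /lyap /merit_gap !lerD2l lerD2r ler_wpM2r //; first exact: breg_hr_ge0.
exact: md_c1 md.
Qed.

(** All iterates x_{k+1} lie in one sublevel set of phi. *)
Lemma iterates_bounded : exists rho : R,
  [/\ 0 < rho, forall k, enorm (x k) <= rho & forall k, enorm (prev k) <= rho].
Proof.
have lk k : lyap cp k <= lyap cp 0.
  elim: k => // k; apply: le_trans; apply: le_trans (lyap_decrease k).
  rewrite lerDl; apply: mulr_ge0; first exact: ltW (md_cp md).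
  by apply: addr_ge0; exact: breg_hr_ge0.
have [M [_ HM]] := md_level md (lyap cp 0).
have xM k : enorm (x k.+1) <= n%:R * (`|M| + 1).
  apply: le_trans (enorm_le_norm _) _; rewrite ler_wpM2l //.
  apply: HM; first by rewrite (le_lt_trans (ler_norm M)) // ltrDl.
  by rewrite /= value_fin lee_fin (le_trans (value_le_lyap k)).
pose rho := n%:R * (`|M| + 1) + enorm (x 0%N) + enorm xm1 + 1.
have nM : 0 <= n%:R * (`|M| + 1) by rewrite mulr_ge0 // addr_ge0.
have e0 := enorm_ge0 (x 0%N); have em := enorm_ge0 xm1.
have x_r k : enorm (x k) <= rho.
  by case: k => [|k]; rewrite /rho; last (have := xM k); lra.
exists rho; split => //; first by rewrite /rho; lra.
by case=> [|k] //=; rewrite /rho; lra.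
Qed.

(** First-order optimality of x_{k+1} in its model. *)
Lemma iterate_subgradient rho K k : hessian_le hh (rho + 1) K -> 0 < K ->
  hessian_le fh (rho + 1) K -> (forall k, enorm (x k) <= rho) ->
  (forall k, enorm (prev k) <= rho) ->
  exists2 v, regular_subdiff phi (x k.+1) v
    & enorm v <= K * (jump k.+1 + jump k).
Proof.
move=> Khh K0 Kfh x_r p_r.
have r1 (w : 'rV[R]_n) : enorm w <= rho -> enorm w <= rho + 1.
  by move/le_trans; apply; rewrite lerDl.
pose u := grad hh (x k.+1) - grad hh (x k) + (grad fh (x k) - grad fh (prev k)).
exists (- u); last first.
  rewrite enormN mulrDr; apply: le_trans (enormD _ _) _; apply: lerD.
    exact: (grad_lipschitz (md_hh md) Khh (r1 _ (x_r _)) (r1 _ (x_r _))).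
  exact: (grad_lipschitz (md_fh md) Kfh (r1 _ (x_r _)) (r1 _ (p_r _))).
apply/regular_subdiffP; split; first by rewrite value_fin.
move=> e e0; exists (Num.min 1 (e / K)).
  by rewrite lt_min ltr01 divr_gt0.
move=> w; rewrite lt_min => /andP[w1 we].
have wr := near_ball (x_r k.+1) w1.
have := md_step md k w; rewrite value_fin.
have [pNy _] := md_proper md; have := pNy w.
case: (phi w) => [a _|_ _|//]; last by rewrite leey.
rewrite -!EFinD !lee_fin => S.
have := breg_le (md_hh md) Khh wr (r1 _ (x_r k.+1)); rewrite ler_norml => /andP[_ B].
have E : model_gap hh fh w (x k) (prev k) - model_gap hh fh (x k.+1) (x k) (prev k)
    = breg hh w (x k.+1) + dot u (w - x k.+1).
  by rewrite /model_gap /breg /u !(dotBl, dotBr, dotDl) !(dotC _ (grad _ _)); ring.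
have {}B : breg hh w (x k.+1) <= e * enorm (w - x k.+1).
  apply: le_trans B _; rewrite expr2 mulrA ler_wpM2r ?enorm_ge0 //.
  by rewrite mulrC -ler_pdivlMr // ltW.
rewrite dotNl; move: E B S.
by move: (model_gap _ _ _ _ _) (model_gap _ _ w _ _) => *; lra.
Qed.

Section Limit.
Variables (rho K : R).
Hypotheses (sm : smooth_data hh fh hr xr c1 rho K)
  (x_rho : forall k, enorm (x k) <= rho) (prev_rho : forall k, enorm (prev k) <= rho).

Lemma merit_gap_jump c k : 0 < c -> c <= c1 ->
  `|merit_gap hh fh hr xr c (x k.+1) (x k) (prev k)|
   <= (c1 + 3) * K * (jump k.+1 + jump k) ^+ 2.
Proof.
move=> c0 cc1; have [a1 a2 a3 a4 K0 a6 a7 a8 a9 a10] := sm.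
have smc : smooth_data hh fh hr xr c rho K by split.
have r1 (w : 'rV[R]_n) : enorm w <= rho -> enorm w <= rho + 1.
  by move/le_trans; apply; rewrite lerDl.
apply: le_trans (merit_gap_le smc (r1 _ (x_rho k.+1)) (r1 _ (x_rho k)) (r1 _ (prev_rho k))) _.
have : 0 <= jump k by exact: enorm_ge0.
have : 0 <= jump k.+1 by exact: enorm_ge0.
rewrite -/(jump k) -/(jump k.+1).
move: (jump k) (jump k.+1) => s t t0 s0.
have h1 : 0 <= K * (s * t) by rewrite !mulr_ge0 // ltW.
have h2 : 0 <= K * t ^+ 2 by rewrite mulr_ge0 ?sqr_ge0 // ltW.
have h3 : 0 <= K * s ^+ 2 by rewrite mulr_ge0 ?sqr_ge0 // ltW.
have h4 := mulr_ge0 (ltW a6) h1; have h5 := mulr_ge0 (ltW a6) h2.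
have h6 := mulr_ge0 (ltW a6) h3.
have h7 : (c + 1) * K * s ^+ 2 <= (c1 + 1) * (K * s ^+ 2).
  by rewrite -mulrA ler_wpM2r // lerD2r.
rewrite -subr_ge0; apply: le_trans (_ : 0 <= (c1 + 2) * (K * t ^+ 2) + 2 * (K * s ^+ 2) + (2 * c1 + 5) * (K * (s * t))) _.
  lra.
move: h7; lra.
Qed.

Variable s : R.
Hypotheses (s0 : 0 < s) (strong : forall w y, enorm w <= rho -> enorm y <= rho ->
  s / 2 * enorm (w - y) ^+ 2 <= breg hr w y).

Lemma lyap_jump k :
  cp * (s / 2) * (jump k.+1 ^+ 2 + jump k ^+ 2) <= lyap cp k - lyap cp k.+1.
Proof.
rewrite lerBrDl; apply: le_trans (lyap_decrease k); rewrite lerD2l -mulrA.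
rewrite ler_pM2l ?(md_cp md) // mulrDr; apply: lerD.
  exact: (strong (x_rho _) (x_rho _)).
exact: (strong (x_rho _) (prev_rho _)).
Qed.

Lemma lyap_nincr : nonincreasing_seq (lyap cp).
Proof.
apply/nonincreasing_seqP => k; rewrite -subr_ge0; apply: le_trans (lyap_jump k).
have c0 := ltW (md_cp md).
by rewrite mulr_ge0 ?addr_ge0 ?sqr_ge0 // mulr_ge0 // divr_ge0 // ltW.
Qed.

Definition limit_value : R := limn (lyap cp).

Lemma lyap_cvg : lyap cp k @[k --> \oo] --> limit_value.
Proof.
apply: nonincreasing_is_cvgn; first exact: lyap_nincr.
have [m Hm] := md_bounded md; exists m => _ [k _ <-].
apply: le_trans (value_le_lyap k).
by have := Hm (x k.+1); rewrite value_fin lee_fin.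
Qed.

Lemma limit_value_le k : limit_value <= lyap cp k.
Proof.
by apply: nonincreasing_cvgn_ge; [exact: lyap_nincr|exact: cvgP lyap_cvg].
Qed.

Lemma jump_cvg0 : jump k @[k --> \oo] --> (0 : R).
Proof.
have cs : 0 < cp * (s / 2) by rewrite mulr_gt0 ?divr_gt0 // (md_cp md).
have D0 : lyap cp k - lyap cp k.+1 @[k --> \oo] --> (0 : R).
  rewrite -(subrr limit_value); apply: cvgB; first exact: lyap_cvg.
  by rewrite (cvg_shiftS (lyap cp)); exact: lyap_cvg.
have D1 : (cp * (s / 2))^-1 * (lyap cp k - lyap cp k.+1) @[k --> \oo] --> (0 : R).
  by rewrite -(mulr0 (cp * (s / 2))^-1); apply: cvgM => //; exact: cvg_cst.
apply/cvgrPdist_lt => e e0.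
have e2 : 0 < e ^+ 2 by rewrite exprn_gt0.
move/cvgrPdist_lt: D1 => /(_ _ e2); apply: filterS => k.
rewrite sub0r normrN => /(le_lt_trans (ler_norm _)) H.
rewrite sub0r normrN ger0_norm ?enorm_ge0 //.
rewrite -(@ltr_pXn2r _ 2) ?nnegrE ?enorm_ge0 ?(ltW e0) //.
apply: le_lt_trans H; rewrite ler_pdivlMl //; apply: le_trans (lyap_jump k).
by rewrite ler_pM2l // lerDr sqr_ge0.
Qed.

Lemma jumpS_cvg0 : jump k.+1 @[k --> \oo] --> (0 : R).
Proof. by rewrite (cvg_shiftS jump); exact: jump_cvg0. Qed.

Lemma merit_gap_cvg0 c : 0 < c -> c <= c1 ->
  merit_gap hh fh hr xr c (x k.+1) (x k) (prev k) @[k --> \oo] --> (0 : R).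
Proof.
move=> c0 cc1; apply/norm_cvg0P.
have B : (c1 + 3) * K * (jump k.+1 + jump k) ^+ 2 @[k --> \oo] --> (0 : R).
  rewrite -(mulr0 ((c1 + 3) * K)); apply: cvgM; first exact: cvg_cst.
  have -> : (0 : R) = (0 + 0) * (0 + 0) by rewrite addr0 mulr0.
  by apply: cvgM; apply: cvgD; (exact: jump_cvg0 || exact: jumpS_cvg0).
apply: (squeeze_cvgr _ (cvg_cst 0) B); apply: nearW => k.
by rewrite normr_ge0 merit_gap_jump.
Qed.

Lemma value_cvg : value k @[k --> \oo] --> limit_value.
Proof.
have -> : value = (fun k => lyap cp k - merit_gap hh fh hr xr cp (x k.+1) (x k) (prev k)).
  by apply/funext => k; rewrite /lyap addrK.
rewrite -[X in _ --> X]subr0; apply: cvgB; first exact: lyap_cvg.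
by apply: merit_gap_cvg0; [exact: md_cp md|exact: md_c1 md].
Qed.

Lemma lyap1_cvg : lyap c1 k @[k --> \oo] --> limit_value.
Proof.
rewrite -[X in _ --> X]addr0; apply: cvgD; first exact: value_cvg.
by apply: merit_gap_cvg0 => //; exact: lt_le_trans (md_cp md) (md_c1 md).
Qed.

End Limit.

End Descent.

(** * Sequences of finite length and their limit points *)

Section LimitPoints.
Context {R : realType} {m : nat}.
Implicit Types (z : nat -> 'rV[R]_m).

Lemma cvg_limit_points z p : z k @[k --> \oo] --> p -> limit_points z p.
Proof.
move=> zp A B FA Bp; have FB := zp _ Bp.
have /filter_ex[k [Ak Bk]] : \forall k \near \oo, A (z k) /\ B (z k).
  exact: filterI FA FB.
by exists (z k).
Qed.

(** Otherwise a subsequence would stay away from the limit points, although by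
   compactness it has one itself. *)
Lemma eventually_near_limit_points z rho r : (forall k, enorm (z k) <= rho) ->
  0 < r -> \forall k \near \oo, exists2 w, limit_points z w & enorm (z k - w) < r.
Proof.
move=> zr r0; apply: contrapT => nev.
pose P k := ~ exists2 w, limit_points z w & enorm (z k - w) < r.
pose G := z k @[k --> within P \oo].
have Pfreq : forall A, within P \oo A -> exists k, A k.
  move=> A HA; apply: contrapT => nA; apply: nev.
  have HA' : \forall k \near \oo, P k -> A k := HA.
  apply: filterS HA' => k {}HA; apply: contrapT => Pk.
  by apply: nA; exists k; exact: HA.
have PG : ProperFilter G by apply: fmap_proper_filter; exact: Build_ProperFilter_ex.
have Gball : G [set u | enorm u <= rho].
  suff : within P \oo [set k | enorm (z k) <= rho] by [].
  by apply: filterE => k; exact: zr.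
have [w [_ wG]] := compact_enorm_le PG Gball.
have wz : limit_points z w.
  apply: (@cvg_cluster _ G _ _ _ wG) => A FA.
  have FA' : \forall k \near \oo, A (z k) := FA.
  suff : \forall k \near \oo, P k -> A (z k) by [].
  by apply: filterS FA' => k Ak _.
have GP : G [set z k | k in P].
  suff : \forall k \near \oo, P k -> [set z k | k in P] (z k) by [].
  by apply: filterE => k Pk; exists k.
have [_ [[k Pk <-] kw]] := wG _ _ GP (nbhs_enorm w r0).
by apply: Pk; exists w.
Qed.

Lemma enorm_telescope z i j : (i <= j)%N ->
  enorm (z j - z i) <= \sum_(i <= k < j) enorm (z k.+1 - z k).
Proof.
move=> /subnKC <-; elim: (j - i)%N => [|l IH].
  by rewrite addn0 subrr enorm0 big_geq.
rewrite addnS big_nat_recr ?leq_addr //=.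
by have := enorm_dist (z (i + l)%N) (z (i + l).+1) (z i); move: IH; lra.
Qed.

Lemma finite_length_cvg z : cvgn (series (fun k => enorm (z k.+1 - z k))) ->
  exists w : 'rV[R]_m, z k @[k --> \oo] --> w.
Proof.
set u := (fun k => _) => cu.
have su := nondecreasing_cvgn_le (nondecreasing_series (fun k _ _ => enorm_ge0 _)) cu.
set S := limn (series u) in su *.
have len i j : (i <= j)%N -> enorm (z j - z i) <= S - series u i.
  move=> ij; apply: le_trans (enorm_telescope z ij) _.
  rewrite lerBrDl; apply: le_trans (su j).
  by rewrite /series /= [leRHS](big_cat_nat (n := i)).
have zb k : enorm (z k) <= enorm (z 0%N) + S.
  have := enorm_dist (z 0%N) (z k) 0; rewrite !subr0 => /le_trans; apply.
  rewrite addrC lerD2l; apply: le_trans (len 0%N k (leq0n k)) _.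
  by rewrite /series /= big_geq // subr0.
have zball : (z k @[k --> \oo]) [set v | enorm v <= enorm (z 0%N) + S].
  suff : \forall k \near \oo, enorm (z k) <= enorm (z 0%N) + S by [].
  exact: nearW.
have [w [_ wz]] := compact_enorm_le (fmap_proper_filter z _) zball.
exists w; apply: enorm_cvg; apply/cvgrPdist_lt => e e0.
have e2 : 0 < e / 2 by rewrite divr_gt0.
have [N _ HN] : \forall k \near \oo, S - series u k < e / 2.
  move/cvgrPdist_lt: cu => /(_ _ e2); apply: filterS => k.
  exact: le_lt_trans (ler_norm _).
have tailN : (z k @[k --> \oo]) [set z k | k in [set k | (N <= k)%N]].
  by exists N => // k Nk; exists k.
have [_ [[i Ni <-] iw]] := wz _ _ tailN (nbhs_enorm w e2).
exists i => // j /= ij; rewrite sub0r normrN ger0_norm ?enorm_ge0 //.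
apply: le_lt_trans (enorm_dist (z i) _ _) _.
have := len i j ij; have := HN i Ni; move: iw => /=; lra.
Qed.

End LimitPoints.

(** * Convergence *)

Section Stationarity.
Variables (R : realType) (n : nat) (phi : 'rV[R]_n -> \bar R)
  (hh fh hr xr : 'rV[R]_n -> R) (c1 cp : R) (x : nat -> 'rV[R]_n) (xm1 : 'rV[R]_n).
Hypothesis md : merit_descent phi hh fh hr xr c1 cp x xm1.
Local Notation prev k := (previous xm1 x k).
Local Notation value := (value phi x).
Local Notation jump := (jump x xm1).
Variables (p : 'rV[R]_n) (mu rho : R).
Hypotheses (xp : x k @[k --> \oo] --> p) (jump0 : jump k @[k --> \oo] --> (0 : R))
  (value_mu : value k @[k --> \oo] --> mu)
  (x_rho : forall k, enorm (x k) <= rho) (prev_rho : forall k, enorm (prev k) <= rho).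

(** Passing to the limit in the minimality of the iterates; only values of the
   smooth part at w and p survive. *)
Lemma limit_minimality w : (mu%:E <= phi w + (breg hh w p)%:E)%E.
Proof.
have [pNy _] := md_proper md; have := pNy w.
case Ew : (phi w) => [a| |] // _; last by rewrite addye // leey.
rewrite -EFinD lee_fin.
pose rho' := rho + enorm w + enorm p.
have rho0 : 0 <= rho := le_trans (enorm_ge0 _) (x_rho 0%N).
have w0 := enorm_ge0 w; have p0 := enorm_ge0 p.
have wr : enorm w <= rho' by rewrite /rho'; lra.
have pr : enorm p <= rho' by rewrite /rho'; lra.
have x_r k : enorm (x k) <= rho' by have := x_rho k; rewrite /rho'; lra.
have p_r k : enorm (prev k) <= rho' by have := prev_rho k; rewrite /rho'; lra.
have [K1 K10 HK1] := hessian_bounded rho' (md_hh md).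
have [K2 K20 HK2] := hessian_bounded rho' (md_fh md).
have [K3 K30 HK3] := hessian_bounded rho' (md_xr md).
have b0 : enorm (x k - p) @[k --> \oo] --> (0 : R).
  exact: enorm_cvg0 xp.
pose W := 2 * rho'.
apply: (@ler_cvg_to _ \oo _ _ (fun k => value k - K3 * (jump k * jump k))
  (fun k => a + (breg hh w p + K1 * (enorm (x k - p) * enorm (x k - p))
    + K1 * W * enorm (x k - p) + K2 * W * jump k))).
- rewrite -[X in _ --> X]subr0; apply: cvgB => //.
  rewrite -(mulr0 K3); apply: cvgM; first exact: cvg_cst.
  by rewrite -(mulr0 (0 : R)); exact: (cvgM jump0 jump0).
- have H1 : K1 * (enorm (x k - p) * enorm (x k - p)) @[k --> \oo] --> K1 * (0 * 0).
    by apply: cvgM; [exact: cvg_cst|exact: (cvgM b0 b0)].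
  have H2 : K1 * W * enorm (x k - p) @[k --> \oo] --> K1 * W * 0.
    by apply: cvgM => //; exact: cvg_cst.
  have H3 : K2 * W * jump k @[k --> \oo] --> K2 * W * 0.
    by apply: cvgM => //; exact: cvg_cst.
  have := cvgD (cvg_cst a) (cvgD (cvgD (cvgD (cvg_cst (breg hh w p)) H1) H2) H3).
  by rewrite !mulr0 !addr0; apply.
apply: nearW => k.
have := md_step md k w; rewrite (value_fin md) Ew -!EFinD lee_fin.
have := md_gap md (x k.+1) (x k) (prev k).
have h1 := mulr_ge0 (ltW (md_cp md)) (breg_hr_ge0 md (x k.+1) (x k)).
have h2 := md_xi md (x k.+1) (x k).
have := breg_le (md_xr md) HK3 (x_r k) (p_r k); rewrite ler_norml => /andP[_ h3].
have gapw : model_gap hh fh w (x k) (prev k) <= breg hh w p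
    + K1 * (enorm (x k - p) * enorm (x k - p)) + K1 * W * enorm (x k - p) + K2 * W * jump k.
  have -> : breg hh w p = breg hh w (x k) + breg hh (x k) p
      + dot (grad hh (x k) - grad hh p) (w - x k).
    by rewrite /breg !(dotBl, dotBr); ring.
  have wx : enorm (w - x k) <= W.
    have := enorm_dist 0 w (x k); rewrite subr0 sub0r enormN /W.
    by have := x_r k; lra.
  have := breg_le (md_hh md) HK1 (x_r k) pr; rewrite ler_norml => /andP[h4 _].
  have h5 : - (K1 * W * enorm (x k - p)) <= dot (grad hh (x k) - grad hh p) (w - x k).
    apply: le_trans (dot_ge _ _); rewrite lerN2 -mulrA (mulrC W) mulrA.
    apply: ler_pM; rewrite ?enorm_ge0 //.
    exact: (grad_lipschitz (md_hh md) HK1 (x_r k) pr).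
  have h6 : dot (w - x k) (grad fh (x k) - grad fh (prev k)) <= K2 * W * jump k.
    apply: le_trans (dot_le _ _) _; rewrite (mulrC K2) -mulrA.
    apply: ler_pM; rewrite ?enorm_ge0 //.
    exact: (grad_lipschitz (md_fh md) HK2 (x_r k) (p_r k)).
  rewrite /model_gap; move: h4 h5 h6; rewrite expr2.
  move: (breg hh w (x k)) (breg hh (x k) p) (dot (_ - grad hh p) _) (dot (w - x k) _).
  move=> *; lra.
move: h1 h2 h3 gapw; rewrite -/(jump k) expr2.
move: (breg hr (x k.+1) _) (breg xr (x k.+1) _) (breg xr (x k) _).
move: (model_gap _ _ (x k.+1) _ _) (model_gap _ _ _ _ _) => *; lra.
Qed.

(** Lower semicontinuity gives phi p <= mu, minimality the converse. *)
Lemma limit_value_attained : phi p = mu%:E.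
Proof.
apply/eqP; rewrite eq_le; apply/andP; split; last first.
  by have := limit_minimality p; rewrite breg_id adde0.
rewrite leNgt; apply/negP => mup.
have [a [mua ap]] : exists a, mu < a /\ (a%:E < phi p)%E.
  move: mup; case: (phi p) => [b| |] //; last first.
    by move=> _; exists (mu + 1); rewrite ltry ltrDl.
  by rewrite lte_fin => mb; exists ((mu + b) / 2); rewrite lte_fin; split; lra.
have [V Vp HV] := md_lsc md ap.
suff : a <= mu by rewrite leNgt mua.
apply: (cvgr_to_ge value_mu).
have xS : x k.+1 @[k --> \oo] --> p by rewrite (cvg_shiftS x).
have : \forall k \near \oo, V (x k.+1) := xS _ Vp.
apply: filterS => k /HV; rewrite (value_fin md) lte_fin; exact: ltW.
Qed.

Lemma limit_stationary : regular_subdiff phi p 0.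
Proof.
apply/regular_subdiffP; rewrite limit_value_attained; split => // e e0.
have [K K0 HK] := hessian_bounded (enorm p + 1) (md_hh md).
exists (Num.min 1 (e / K)); first by rewrite lt_min ltr01 divr_gt0.
move=> w; rewrite lt_min => /andP[w1 we].
have wr := near_ball (lexx (enorm p)) w1.
have pr : enorm p <= enorm p + 1 by rewrite lerDl.
have := breg_le (md_hh md) HK wr pr; rewrite ler_norml => /andP[_ B].
have {}B : breg hh w p <= e * enorm (w - p).
  apply: le_trans B _; rewrite expr2 mulrA ler_wpM2r ?enorm_ge0 //.
  by rewrite mulrC -ler_pdivlMr // ltW.
have := limit_minimality w; have [pNy _] := md_proper md; have := pNy w.
case: (phi w) => [a _|_ _|//]; last by rewrite leey.
rewrite -!EFinD !lee_fin dot0l; move: B; lra.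
Qed.

End Stationarity.

(** * Finite length under the Kurdyka-Lojasiewicz property *)

Lemma in_enlargement (R : realType) (m : nat) (S : set 'rV[R]_m) (r : R) z w :
  S w -> enorm (z - w) < r -> enlargement S r z.
Proof.
move=> Sw zw; rewrite /enlargement /= /setdist.
apply: (@le_lt_trans _ _ (enorm (z - w))%:E); last by rewrite lte_fin.
by apply: ereal_inf_lbound; exists w.
Qed.

Lemma near_lt_eta (R : realType) (u : nat -> R) (eta : \bar R) : (0 < eta)%E ->
  u k @[k --> \oo] --> (0 : R) -> \forall k \near \oo, ((u k)%:E < eta)%E.
Proof.
case: eta => [e| |] //; last by move=> _ _; apply: nearW => k; exact: ltry.
rewrite lte_fin => e0 /cvgrPdist_lt /(_ _ e0); apply: filterS => k.
by rewrite sub0r normrN lte_fin => /(le_lt_trans (ler_norm _)).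
Qed.

Section Length.
Variables (R : realType) (n : nat) (phi : 'rV[R]_n -> \bar R)
  (hh fh hr xr : 'rV[R]_n -> R) (c1 cp : R) (x : nat -> 'rV[R]_n) (xm1 : 'rV[R]_n).
Hypothesis md : merit_descent phi hh fh hr xr c1 cp x xm1.
Variables (rho K s : R).
Local Notation prev k := (previous xm1 x k).
Hypotheses (sm : smooth_data hh fh hr xr c1 rho K)
  (x_rho : forall k, enorm (x k) <= rho) (prev_rho : forall k, enorm (prev k) <= rho).
Hypotheses (s0 : 0 < s) (strong : forall w y, enorm w <= rho -> enorm y <= rho ->
  s / 2 * enorm (w - y) ^+ 2 <= breg hr w y).
Local Notation value := (value phi x).
Local Notation jump := (jump x xm1).
Local Notation lyapx c := (lyap phi hh fh hr xr x xm1 c).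
Local Notation mu := (limit_value phi hh fh hr xr cp x xm1).
Local Notation F := (real_merit phi hh fh hr xr c1).
Local Notation Omega := (limit_points (fun k => triple (x k.+1) (x k) (prev k))).
Variables (r : R) (eta : \bar R).
Hypotheses (r0 : 0 < r) (eta0 : (0 < eta)%E).
Local Notation U := (enlargement Omega r).
Hypothesis KL : setwise_KL F Omega U mu%:E eta.
Local Notation G := (exact_modulus F U mu%:E eta).

Let jump0 := jump_cvg0 md x_rho prev_rho s0 strong.
Let jumpS0 := jumpS_cvg0 md x_rho prev_rho s0 strong.
Let value_mu := value_cvg md sm x_rho prev_rho s0 strong.

(** The triples of iterates approach Omega, and the diagonal points approach the
   triples because the jumps vanish. *)
Lemma diagonal_in_U :
  \forall k \near \oo, U (triple (x k.+1) (x k.+1) (x k.+1)).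
Proof.
have zb k : enorm (triple (x k.+1) (x k) (prev k)) <= 3 * rho.
  apply: le_trans (enorm_triple _ _ _) _.
  by have := x_rho k.+1; have := x_rho k; have := prev_rho k; lra.
have r2 : 0 < r / 2 by rewrite divr_gt0.
have N1 := eventually_near_limit_points zb r2.
have r8 : 0 < r / 8 by rewrite divr_gt0.
have N2 : \forall k \near \oo, jump k < r / 8.
  move/cvgrPdist_lt: jump0 => /(_ _ r8); apply: filterS => k.
  by rewrite sub0r normrN => /(le_lt_trans (ler_norm _)).
have N3 : \forall k \near \oo, jump k.+1 < r / 8.
  move/cvgrPdist_lt: jumpS0 => /(_ _ r8); apply: filterS => k.
  by rewrite sub0r normrN => /(le_lt_trans (ler_norm _)).
near=> k.
have [w Ow zw] : exists2 w, Omega w & enorm (triple (x k.+1) (x k) (prev k) - w) < r / 2.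
  by near: k.
apply: (in_enlargement Ow).
apply: le_lt_trans (enorm_dist (triple (x k.+1) (x k) (prev k)) _ _) _.
have j1 : jump k < r / 8 by near: k.
have j2 : jump k.+1 < r / 8 by near: k.
have : enorm (triple (x k.+1) (x k.+1) (x k.+1) - triple (x k.+1) (x k) (prev k))
    <= jump k.+1 + (jump k.+1 + jump k).
  rewrite tripleB; apply: le_trans (enorm_triple _ _ _) _.
  by rewrite subrr enorm0 add0r lerD2l; exact: enorm_dist.
lra.
Unshelve. all: by end_near. Qed.

(** The square root accounts for the iterations at which the quadratic part of
   the Lyapunov gap dominates the excess of phi. *)
Definition desing (t : R) : R := 2 * G (t / 2) + Num.sqrt t.
Local Notation gap k := (lyapx cp k - mu).

Definition length_const : R := K + 2 * Num.sqrt (2 * ((c1 + 3) * K)).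

Lemma gap_ge0 k : 0 <= gap k.
Proof.
by rewrite subr_ge0; exact: (limit_value_le md x_rho prev_rho s0 strong).
Qed.

Lemma gap_nincr k : gap k.+1 <= gap k.
Proof.
rewrite lerD2r; have /nonincreasing_seqP := lyap_nincr md x_rho prev_rho s0 strong.
exact.
Qed.

Lemma desing_le (a b : R) : 0 <= a -> a <= b -> (b%:E < eta)%E -> desing a <= desing b.
Proof.
move=> a0 ab be; apply: lerD; last by rewrite ler_wsqrtr.
rewrite ler_pM2l //; apply: (exact_modulus_le KL); [lra|lra|].
by apply: le_lt_trans be; rewrite lee_fin; lra.
Qed.

Lemma KL_step k : U (triple (x k.+1) (x k.+1) (x k.+1)) ->
  ((value k - mu)%:E < eta)%E -> ((gap k)%:E < eta)%E ->
  gap k - gap k.+1 <= length_const * (jump k.+1 + jump k)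
    * (desing (gap k) - desing (gap k.+1)).
Proof.
move=> Uk ve ge; have [_ _ _ _ K0 c10 Khh Kfh _ _] := sm.
have g0 := gap_ge0 k; have g1 := gap_ge0 k.+1; have gn := gap_nincr k.
have [v vphi vle] := iterate_subgradient md k Khh K0 Kfh x_rho prev_rho.
have vF := merit_subdiff_diag sm (x_rho k.+1) vphi.
have S0 : 0 <= jump k.+1 + jump k by rewrite addr_ge0 // enorm_ge0.
pose q := Num.sqrt (2 * ((c1 + 3) * K)).
have q0 : 0 <= q by exact: sqrtr_ge0.
have cK : 0 <= (c1 + 3) * K by rewrite mulr_ge0 ?addr_ge0 // ltW.
have Gn : G (gap k.+1 / 2) <= G (gap k / 2).
  apply: (exact_modulus_le KL); [lra|lra|].
  by apply: le_lt_trans ge; rewrite lee_fin; lra.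
have Sn : Num.sqrt (gap k.+1) <= Num.sqrt (gap k) by rewrite ler_wsqrtr.
rewrite /length_const -/q mulrDl mulrDl.
pose X := 2 * G (gap k / 2) - 2 * G (gap k.+1 / 2).
pose Y := Num.sqrt (gap k) - Num.sqrt (gap k.+1).
have D1 : 0 <= X by rewrite subr_ge0 ler_pM2l.
have D2 : 0 <= Y by rewrite subr_ge0.
have DE : desing (gap k) - desing (gap k.+1) = X + Y.
  by rewrite /desing /X /Y opprD addrACA.
rewrite DE.
have KS : 0 <= K * (jump k.+1 + jump k) by rewrite mulr_ge0 // ltW.
have qS : 0 <= 2 * q * (jump k.+1 + jump k) by rewrite !mulr_ge0.
have [le2|lt2] := leP (gap k) (2 * (value k - mu)).
  (* phi carries half of the gap: use the KL inequality at the diagonal point. *)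
  apply: (@le_trans _ _ (K * (jump k.+1 + jump k) * X)); last first.
    by apply: le_trans (ler_wpM2l KS (_ : _ <= X + Y)) _;
      rewrite lerDl // mulr_ge0 // addr_ge0.
  have Fz : F (triple (x k.+1) (x k.+1) (x k.+1)) = (mu + (value k - mu))%:E.
    rewrite real_merit_triple (value_fin md) /merit_gap model_gap_id !breg_id.
    by rewrite mulr0 !addr0 (addrC mu) subrK.
  have := exact_modulus_gain KL Uk Fz ve (regular_limiting vF)
    (a := gap k.+1 / 2) (b := gap k / 2).
  have vn : enorm (triple v 0 0) <= K * (jump k.+1 + jump k).
    apply: le_trans (enorm_triple _ _ _) _.
    by rewrite !enorm0 !addr0.
  have Gd : 0 <= G (gap k / 2) - G (gap k.+1 / 2) by rewrite subr_ge0.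
  have := ler_wpM2r Gd vn.
  move=> H1 H2; have {}H2 := le_trans (H2 _ _ _) H1.
  have -> : gap k - gap k.+1 = 2 * (gap k / 2 - gap k.+1 / 2).
    by rewrite mulrBr !(mulrC 2) !divfK.
  rewrite /X -mulrBr mulrCA ler_pM2l //; apply: H2.
  - by rewrite divr_ge0.
  - by rewrite ler_pM2r // invr_gt0.
  - by rewrite ler_pdivrMr // mulrC.
(* Otherwise the gap is bounded by the squared jumps. *)
have gb : gap k <= 2 * ((c1 + 3) * K * (jump k.+1 + jump k) ^+ 2).
  have := merit_gap_jump sm x_rho prev_rho k (md_cp md) (md_c1 md).
  move=> /(le_trans (ler_norm _)).
  have -> : merit_gap hh fh hr xr cp (x k.+1) (x k) (prev k) = gap k - (value k - mu).
    by rewrite /lyap; ring.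
  by move: lt2; move: (lyapx cp k) (value k) (_ * _ ^+ 2) => *; lra.
have sq : Num.sqrt (gap k) <= q * (jump k.+1 + jump k).
  rewrite -(@ler_pXn2r _ 2) ?nnegrE ?sqrtr_ge0 ?mulr_ge0 // exprMn !sqr_sqrtr //.
    by apply: le_trans gb _; rewrite !mulrA.
  by rewrite mulr_ge0.
apply: (@le_trans _ _ (2 * q * (jump k.+1 + jump k) * Y)); last first.
  by apply: le_trans (ler_wpM2l qS (_ : _ <= X + Y)) _;
    rewrite lerDr // mulr_ge0 // addr_ge0.
rewrite /Y -{1}(sqr_sqrtr g0) -{1}(sqr_sqrtr g1) subr_sqr mulrC ler_wpM2r //.
rewrite (_ : 2 * q * _ = q * (jump k.+1 + jump k) + q * (jump k.+1 + jump k)).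
  exact: lerD sq (le_trans Sn sq).
by ring.
Qed.

Lemma gap_cvg0 : gap k @[k --> \oo] --> (0 : R).
Proof.
rewrite -(subrr mu); apply: cvgB; last exact: cvg_cst.
exact: (lyap_cvg md x_rho prev_rho s0 strong).
Qed.

Lemma length_bound : exists k0 C, 0 < C /\ forall m, (k0 <= m)%N ->
  forall N, \sum_(m <= k < N) jump k.+1 <= C * desing (gap m).
Proof.
have [_ _ _ _ K0 c10 _ _ _ _] := sm.
have v0 : (value k - mu) @[k --> \oo] --> (0 : R).
  by rewrite -(subrr mu); apply: cvgB => //; exact: cvg_cst.
have [k0 _ Hk0] : \forall k \near \oo, [/\ U (triple (x k.+1) (x k.+1) (x k.+1)),
    ((value k - mu)%:E < eta)%E & ((gap k)%:E < eta)%E].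
  near=> k; split; near: k; first exact: diagonal_in_U.
    exact: near_lt_eta v0.
  exact: near_lt_eta gap_cvg0.
have A0 : 0 < cp * (s / 2) by rewrite mulr_gt0 ?divr_gt0 // (md_cp md).
have B0 : 0 < length_const by rewrite ltr_pwDl // mulr_ge0 // sqrtr_ge0.
exists k0, (2 * length_const / (cp * (s / 2))); split.
  by rewrite divr_gt0 // mulr_gt0.
apply: (@telescoped_length _ jump (fun k => gap k)) => //.
- by move=> k; exact: enorm_ge0.
- move=> k _; rewrite opprB addrA subrK.
  exact: (lyap_jump md x_rho prev_rho strong).
- by move=> k /Hk0[h1 h2 h3]; exact: KL_step.
- move=> k /Hk0[_ _ ge]; apply: desing_le => //; [exact: gap_ge0|exact: gap_nincr].
- move=> k /Hk0[_ _ ge]; rewrite /desing addr_ge0 ?sqrtr_ge0 // mulr_ge0 //.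
  rewrite -(exact_modulus0 F U eta mu); have g0 := gap_ge0 k.
  apply: (exact_modulus_le KL); [lra|lra|].
  by apply: le_lt_trans ge; rewrite lee_fin; lra.
Unshelve. all: by end_near. Qed.

Lemma finite_length : cvgn (series (fun k => enorm (x k.+1 - x k))).
Proof.
have [k0 [C [C0 H]]] := length_bound.
have := @series_tail_bound _ (fun k => enorm (x k.+1 - x k)) (C * desing (gap k0)) k0.
case=> // [k|]; first exact: enorm_ge0.
by move=> N; exact: H.
Qed.

(** The points (p, p, q) show that the modulus is at least of the order of the
   square root. *)
Lemma sqrt_le_modulus (p d : 'rV[R]_n) : x k @[k --> \oo] --> p -> enorm p < rho -> enorm d = 1 ->
  exists C t0 : R, [/\ 0 < C, 0 < t0 &
    forall t, 0 <= t -> t < t0 -> (t%:E < eta)%E /\ Num.sqrt t <= C * G t].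
Proof.
move=> xp pr d1; have [C2hh C2fh C2hr C2xr K0 c10 Khh Kfh Khr Kxr] := sm.
have statp := limit_stationary md xp jump0 value_mu x_rho prev_rho.
have phip := limit_value_attained md xp jump0 value_mu x_rho prev_rho.
have ppO : Omega (triple p p p).
  apply: cvg_limit_points; apply: enorm_cvg.
  have xS : x k.+1 @[k --> \oo] --> p by rewrite (cvg_shiftS x).
  have b0 : enorm (x k - p) @[k --> \oo] --> (0 : R) by exact: enorm_cvg0 xp.
  have b1 : enorm (x k.+1 - p) @[k --> \oo] --> (0 : R) by exact: enorm_cvg0 xS.
  have B : enorm (x k.+1 - p) + enorm (x k - p) + (jump k + enorm (x k - p))
      @[k --> \oo] --> (0 : R).
    have := cvgD (cvgD b1 b0) (cvgD jump0 b0); rewrite !addr0; exact.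
  apply: (squeeze_cvgr _ (cvg_cst 0) B); apply: nearW => k.
  rewrite enorm_ge0 tripleB /=; apply: le_trans (enorm_triple _ _ _) _.
  rewrite lerD2l; apply: le_trans (enorm_dist (x k) _ _) _.
  by rewrite lerD2r (enormB (prev k)).
pose c := c1 * (s / 2); have c0 : 0 < c by rewrite mulr_gt0 // divr_gt0.
pose M := (c1 + 1) * K; have M0 : 0 < M by rewrite mulr_gt0 // addr_gt0.
(* The three bounds in t0 below keep, in turn, the merit at (p, p, q) under
   mu + eta, the point in U, and q in the ball. *)
have [e [e0 ee]] : exists e : R, 0 < e /\ (e%:E <= eta)%E.
  move: eta0; case: (eta) => [e| |] //.
    by rewrite lte_fin; exists e.
  by exists 1; rewrite leey.
pose t0 := Num.min (c * (e / M)) (Num.min (c * r ^+ 2) (c * (rho - enorm p) ^+ 2)).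
have rp : 0 < rho - enorm p by rewrite subr_gt0.
pose C := (2 * c1 + 4) * K / Num.sqrt c.
have sc0 : 0 < Num.sqrt c by rewrite sqrtr_gt0.
have C0 : 0 < C by rewrite divr_gt0 // mulr_gt0 // addr_gt0 // mulr_gt0.
exists C, t0; split => //.
  rewrite !lt_min; apply/and3P; split; apply: mulr_gt0 => //.
  - exact: divr_gt0.
  - exact: exprn_gt0.
  - exact: exprn_gt0.
move=> t tge; rewrite !lt_min => /and3P[t1 t2 t3].
pose tau := Num.sqrt (t / c).
have tc : 0 <= t / c by rewrite divr_ge0 // ltW.
have tau2 : tau ^+ 2 = t / c by rewrite sqr_sqrtr.
have tau0 : 0 <= tau by exact: sqrtr_ge0.
have tauE : tau = Num.sqrt t / Num.sqrt c by rewrite /tau sqrtrM // sqrtrV // ltW.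
have taur : tau < r.
  by rewrite -(@ltr_pXn2r _ 2) ?nnegrE ?(ltW r0) // tau2 ltr_pdivrMr // mulrC.
have taup : tau < rho - enorm p.
  by rewrite -(@ltr_pXn2r _ 2) ?nnegrE ?(ltW rp) // tau2 ltr_pdivrMr // mulrC.
pose q := p + tau *: d.
have pq : enorm (p - q) = tau.
  by rewrite /q opprD addrA subrr add0r enormN enormZ d1 mulr1 ger0_norm.
have qr : enorm q <= rho.
  apply: le_trans (enormD _ _) _; rewrite enormZ d1 mulr1 ger0_norm //; lra.
have [V VF Vle] := merit_subdiff_offdiag sm (ltW pr) qr statp.
have UV : U (triple p p q).
  apply: (in_enlargement ppO); rewrite tripleB !subrr.
  apply: le_lt_trans (enorm_triple _ _ _) _.
  by rewrite enorm0 !add0r enormB pq.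
pose ex := c1 * breg hr p q + breg xr p q.
have Fz : F (triple p p q) = (mu + ex)%:E.
  by rewrite real_merit_triple phip /merit_gap model_gap_id add0r -EFinD.
have tex : t <= ex.
  have h1 := ler_wpM2l (ltW c10) (strong (ltW pr) qr).
  have h2 := md_xi md p q.
  have <- : c1 * (s / 2 * enorm (p - q) ^+ 2) = t.
    by rewrite pq tau2 mulrA -/c mulrC divfK // gt_eqF.
  by rewrite /ex; lra.
have r1 (w : 'rV[R]_n) : enorm w <= rho -> enorm w <= rho + 1.
  by move/le_trans; apply; rewrite lerDl.
have exe : (ex%:E < eta)%E.
  apply: lt_le_trans ee; rewrite lte_fin.
  have := breg_le C2hr Khr (r1 _ (ltW pr)) (r1 _ qr); rewrite ler_norml => /andP[_ h1].
  have := breg_le C2xr Kxr (r1 _ (ltW pr)) (r1 _ qr); rewrite ler_norml => /andP[_ h2].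
  apply: (@le_lt_trans _ _ (M * (t / c))).
    rewrite -tau2 -pq /ex /M; have := ler_wpM2l (ltW c10) h1; lra.
  by rewrite mulrC -ltr_pdivlMr // ltr_pdivrMr // mulrC.
have te : (t%:E < eta)%E by apply: le_lt_trans exe; rewrite lee_fin.
split => //.
have := exact_modulus_gain KL UV Fz exe (regular_limiting VF) (lexx 0) tge tex.
rewrite !subr0 exact_modulus0 subr0 => gain.
have Gt : 0 <= G t.
  rewrite -(exact_modulus0 F U eta mu); exact: (exact_modulus_le KL).
have {gain} : t <= C * Num.sqrt t * G t.
  apply: le_trans gain _; rewrite ler_wpM2r //; apply: le_trans Vle _.
  by rewrite pq tauE /C le_eqVlt; apply/orP; left; apply/eqP; ring.
have [->|tn0] := eqVneq t 0; first by move=> _; rewrite sqrtr0 exact_modulus0 mulr0 lexx.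
have st : 0 < Num.sqrt t by rewrite sqrtr_gt0 lt_def tn0.
by rewrite -{1}(sqr_sqrtr tge) expr2 mulrAC ler_pM2r.
Qed.

End Length.

Section Conclusion.
Variables (R : realType) (n : nat) (phi : 'rV[R]_n -> \bar R)
  (hh fh hr xr : 'rV[R]_n -> R) (c1 cp : R) (x : nat -> 'rV[R]_n) (xm1 : 'rV[R]_n).
Hypothesis md : merit_descent phi hh fh hr xr c1 cp x xm1.
Variables (r : R) (eta : \bar R).
Hypotheses (r0 : 0 < r) (eta0 : (0 < eta)%E).
Local Notation mu := (limit_value phi hh fh hr xr cp x xm1).
Local Notation F := (real_merit phi hh fh hr xr c1).
Local Notation Omega :=
  (limit_points (fun k => triple (x k.+1) (x k) (previous xm1 x k))).
Local Notation U := (enlargement Omega r).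
Local Notation G := (exact_modulus F U mu%:E eta).
Local Notation excess l := (lyap phi hh fh hr xr x xm1 c1 l - mu).

(** The distance 1 between the two radii keeps the limit of the iterates in the
   interior of the ball of radius rho, where points (p, p, q) are needed. *)
Definition iteration_bounds (rho K s : R) :=
  [/\ 0 < s, smooth_data hh fh hr xr c1 rho K,
      forall k, enorm (x k) <= rho - 1,
      forall k, enorm (previous xm1 x k) <= rho
    & forall w y, enorm w <= rho -> enorm y <= rho ->
        s / 2 * enorm (w - y) ^+ 2 <= breg hr w y].

Lemma iteration_boundsP : exists rho K s, 1 < rho /\ iteration_bounds rho K s.
Proof.
have [rho [rho0 xb pb]] := iterates_bounded md.
exists (rho + 1).
have [K1 K10 H1] := hessian_bounded (rho + 1 + 1) (md_hh md).
have [K2 K20 H2] := hessian_bounded (rho + 1 + 1) (md_fh md).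
have [K3 K30 H3] := hessian_bounded (rho + 1 + 1) (md_hr md).
have [K4 K40 H4] := hessian_bounded (rho + 1 + 1) (md_xr md).
have [s s0 Hs] := grad_strongly_monotone (md_hr md) (md_posdef md) (rho + 1).
exists (K1 + K2 + K3 + K4), s; split; first lra.
split => //.
- split; [exact: md_hh md|exact: md_fh md|exact: md_hr md|exact: md_xr md|lra| | | | |].
  + exact: lt_le_trans (md_cp md) (md_c1 md).
  + by apply: hessian_leW H1; lra.
  + by apply: hessian_leW H2; lra.
  + by apply: hessian_leW H3; lra.
  + by apply: hessian_leW H4; lra.
- by move=> k; rewrite addrK.
- by move=> k; apply: le_trans (pb k) _; rewrite lerDl.
- exact: breg_strong (md_hr md) Hs.
Qed.

Variables (rho K s : R).
Hypothesis ib : iteration_bounds rho K s.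

Let s0 : 0 < s. Proof. by case: ib. Qed.
Let sm : smooth_data hh fh hr xr c1 rho K. Proof. by case: ib. Qed.
Let x_in k : enorm (x k) <= rho - 1. Proof. by case: ib. Qed.
Let x_rho k : enorm (x k) <= rho.
Proof. by apply: le_trans (x_in k) _; rewrite gerBl. Qed.
Let prev_rho k : enorm (previous xm1 x k) <= rho. Proof. by case: ib. Qed.
Let strong : forall w y, enorm w <= rho -> enorm y <= rho ->
  s / 2 * enorm (w - y) ^+ 2 <= breg hr w y.
Proof. by case: ib. Qed.

Lemma excess_cvg0 : excess l @[l --> \oo] --> (0 : R).
Proof.
rewrite -(subrr mu); apply: cvgB; last exact: cvg_cst.
exact: (lyap1_cvg md sm x_rho prev_rho s0 strong).
Qed.

Lemma excess_ge0 l : 0 <= excess l.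
Proof.
rewrite subr_ge0; apply: le_trans (lyap_le md l).
exact: (limit_value_le md x_rho prev_rho s0 strong).
Qed.

Hypothesis KL : setwise_KL F Omega U mu%:E eta.

Lemma iterates_cvg : exists2 p, x k @[k --> \oo] --> p &
  regular_subdiff phi p 0 /\ enorm p < rho.
Proof.
have fl := finite_length md sm x_rho prev_rho s0 strong r0 eta0 KL.
have [p xp] := finite_length_cvg fl; exists p => //; split.
  exact: (limit_stationary md xp (jump_cvg0 md x_rho prev_rho s0 strong)
    (value_cvg md sm x_rho prev_rho s0 strong) x_rho prev_rho).
apply: (@le_lt_trans _ _ (rho - 1)); last by rewrite gtrBl.
have H : enorm (x k) @[k --> \oo] --> enorm p.
  exact: (cvg_comp _ _ xp (@enorm_continuous R n p)).
by apply: (cvgr_to_le H); exact: nearW.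
Qed.

Lemma modulus_excess_ge0 l : ((excess l)%:E < eta)%E -> 0 <= G (excess l).
Proof.
move=> le; rewrite -(exact_modulus0 F U eta mu).
by apply: (exact_modulus_le KL) => //; exact: excess_ge0.
Qed.

(** Here the square root in desing is traded for the modulus itself. The unit vector
   d provides a direction along which q can leave p. *)
Lemma tail_bound (d : 'rV[R]_n) : enorm d = 1 -> exists k0 C, 0 < C /\ forall l, (k0 < l)%N ->
  ((excess l)%:E < eta)%E /\
  limn (series (fun k => enorm (x k.+1 - x k)))
    <= \sum_(0 <= k < l.+1) enorm (x k.+1 - x k) + C * G (excess l).
Proof.
move=> d1; have [p xp [_ pr]] := iterates_cvg.
have [C1 [t0 [C10 t00 HC1]]] :=
  sqrt_le_modulus md sm x_rho prev_rho s0 strong r0 eta0 KL xp pr d1.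
have [k1 [C2 [C20 HC2]]] := length_bound md sm x_rho prev_rho s0 strong r0 eta0 KL.
have [k2 _ Hk2] : \forall l \near \oo, excess l < t0.
  move/cvgrPdist_lt: excess_cvg0 => /(_ _ t00); apply: filterS => l.
  by rewrite sub0r normrN => /(le_lt_trans (ler_norm _)).
exists (maxn k1 k2), (C2 * (2 + C1)); split.
  by rewrite mulr_gt0 // addr_gt0.
move=> l; rewrite gtn_max => /andP[k1l k2l].
have tl := Hk2 l (ltnW k2l); have e0 := excess_ge0 l.
have [el sq] := HC1 _ e0 tl; split => //.
have k1l' : (k1 <= l.+1)%N by exact: leq_trans (ltnW k1l) (leqnSn l).
have [_ H] := @series_tail_bound _ (fun k => enorm (x k.+1 - x k)) _ l.+1
    (fun k => enorm_ge0 _) (HC2 l.+1 k1l').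
apply: le_trans H _; rewrite lerD2l -mulrA ler_pM2l // mulrDl.
have g0 := gap_ge0 md x_rho prev_rho s0 strong l.+1.
have gl : lyap phi hh fh hr xr x xm1 cp l.+1 - mu <= excess l.
  apply: le_trans (gap_nincr md x_rho prev_rho s0 strong l) _.
  by rewrite lerD2r; exact: lyap_le.
apply: le_trans (desing_le KL g0 gl el) _; rewrite /desing lerD //.
rewrite ler_pM2l //; apply: (exact_modulus_le KL) => //.
  by rewrite divr_ge0.
by rewrite ler_pdivrMr // ler_peMr // ler1n.
Qed.

End Conclusion.

(** * Admissible parameters give a descent *)

Section Translation.
Context {R : realType} {n : nat}.
Implicit Types (h f g F : 'rV[R]_n -> \bar R).

Lemma C2_twice F : C2 F -> twice_C (fine \o F).
Proof. by move=> [d1 d2 d3]; split => // z; have [] := d1 z. Qed.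

Lemma kernel_finite h : legendre_kernel setT h -> forall w, h w \is a fin_num.
Proof.
move=> lk w; have [pNy _] := kernel_proper lk.
have : interior (edom h) w by rewrite (kernel_interior lk).
by move=> /nbhs_singleton hw; rewrite fin_numElt pNy.
Qed.

Lemma smooth_finite h f g : legendre_kernel setT h -> standing_assumptions setT h f g ->
  forall w, f w \is a fin_num.
Proof.
move=> lk sa w; have [pNy _] := smooth_proper sa.
have hw : edom h w by rewrite /edom /= ltey_eq (kernel_finite lk).
by rewrite fin_numElt pNy; exact: (smooth_dom sa) hw.
Qed.

Section Finite.
Variables (h f : 'rV[R]_n -> \bar R).
Hypotheses (hfin : forall w, h w \is a fin_num) (ffin : forall w, f w \is a fin_num).

Lemma hhatE gamma : hhat h f gamma =
  EFin \o lincomb gamma^-1 (-1) (fine \o h) (fine \o f).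
Proof.
apply/funext => w; rewrite /hhat /lincomb /=.
by case: (h w) (hfin w) => // a _; case: (f w) (ffin w) => // b _; rewrite /= mulN1r.
Qed.

Lemma fhatE gamma beta : fhat h f gamma beta =
  EFin \o lincomb 1 (- (beta / gamma)) (fine \o f) (fine \o h).
Proof.
apply/funext => w; rewrite /fhat /lincomb /=.
case: (h w) (hfin w) => // a _; case: (f w) (ffin w) => // b _.
by rewrite /= mul1r mulNr.
Qed.

Lemma bregmanE F : (forall w, F w \is a fin_num) ->
  forall w y, bregman F w y = (breg (fine \o F) w y)%:E.
Proof.
move=> Ff w y; rewrite /bregman /breg /=.
by rewrite -{1}(fineK (Ff w)) -{1}(fineK (Ff y)).
Qed.

Lemma modelE g gamma beta w z y : model h f g gamma beta w z y =
  (cost f g w + (model_gap (fine \o hhat h f gamma) (fine \o fhat h f gamma beta) w z y)%:E)%E.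
Proof.
rewrite /model /model_gap bregmanE; last by move=> v; rewrite hhatE.
by rewrite -addeA -EFinD.
Qed.

Lemma meritE g gamma beta c xi : (forall w, xi w \is a fin_num) ->
  merit h f g gamma beta c xi = real_merit (cost f g) (fine \o hhat h f gamma)
    (fine \o fhat h f gamma beta) (fine \o h) (fine \o xi) (c / (2 * gamma)).
Proof.
move=> xif; apply/funext => z; rewrite /merit /real_merit /merit_gap modelE.
by rewrite !bregmanE // -EFinM -!addeA -!EFinD.
Qed.

End Finite.

Lemma cost_proper h f g : legendre_kernel setT h -> standing_assumptions setT h f g ->
  proper_fun (cost f g).
Proof.
move=> lk sa; have ff := smooth_finite lk sa; have [gNy [w gw]] := nonsmooth_proper sa.
split.
  move=> v; rewrite /cost -(fineK (ff v)); move: (gNy v).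
  by case: (g v) => [t| |] // _; rewrite -?EFinD ?addey ?ltNyr ?ltNyy.
exists w; move: gw (gNy w); rewrite /edom /cost /= -(fineK (ff w)).
by case: (g w) => // t _ _; rewrite -EFinD ltry.
Qed.

Lemma cost_lsc h f g : legendre_kernel setT h -> standing_assumptions setT h f g ->
  twice_C (fine \o f) -> lower_semicontinuous (cost f g).
Proof.
move=> lk sa [df _ _] w a; have ff := smooth_finite lk sa.
rewrite /cost -{1}(fineK (ff w)) => aw.
have [b [bg ab]] : exists b, (b%:E < g w)%E /\ a < fine (f w) + b.
  have [gNy _] := nonsmooth_proper sa; have := gNy w; move: aw.
  case: (g w) => [t| |] //.
    rewrite -EFinD lte_fin => aw _; exists (t - (fine (f w) + t - a) / 2).
    by rewrite lte_fin; split; lra.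
  by move=> _ _; exists (a - fine (f w) + 1); rewrite ltry; split => //; lra.
have [V Vw HV] := nonsmooth_lsc sa bg.
have e0 : 0 < fine (f w) + b - a by lra.
have cf : {for w, continuous (fine \o f : 'rV[R]_n -> R^o)}.
  exact: differentiable_continuous (df w).
have /cvgrPdist_lt /(_ _ e0) near_f := cf.
exists (V `&` [set y | `|fine (f w) - fine (f y)| < fine (f w) + b - a]).
  exact: filterI.
move=> y [Vy /ltr_normlW fy]; have := HV y Vy.
rewrite -(fineK (ff y)); case: (g y) => [t| |] //; last by move=> _; rewrite addey // ltry.
by rewrite -EFinD !lte_fin; lra.
Qed.

Lemma cost_bounded h f g : standing_assumptions setT h f g ->
  exists m : R, forall w, (m%:E <= cost f g w)%E.
Proof.
move=> sa; have := cost_bounded_below sa.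
case EE : (ereal_inf _) => [m| |] // _.
  exists m => w; rewrite -EE; apply: ereal_inf_lbound; exists w => //.
  by rewrite /indicator mem_set ?adde0 //; exact: subset_closure.
exists 0 => w; apply: (@le_trans _ _ +oo%E); first by rewrite leey.
rewrite -EE; apply: ereal_inf_lbound; exists w => //.
by rewrite /indicator mem_set ?adde0 //; exact: subset_closure.
Qed.

Lemma three_point (psi : 'rV[R]_n -> R) w z y :
  dot (w - z) (grad psi z - grad psi y) = breg psi w y - breg psi w z - breg psi z y.
Proof. by rewrite /breg !(dotBl, dotBr) !(dotC _ (grad _ _)); ring. Qed.

(** The gradient inequality for the convex function - f - sigmf h. *)
Lemma relative_breg_le h f sigf sigmf : relative_constants setT h f sigf sigmf ->
  twice_C (fine \o h) -> twice_C (fine \o f) ->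
  forall w y, sigmf * breg (fine \o h) w y <= - breg (fine \o f) w y.
Proof.
move=> rc C2h C2f w y; have C2l := twice_C_lincomb (-1) (- sigmf) C2f C2h.
have [d _ _] := C2l.
have cv : convex_function setT (lincomb (-1) (- sigmf) (fine \o f) (fine \o h)).
  have := relative_concave rc; congr convex_function; apply/funext => z.
  by rewrite /lincomb /= mulN1r mulNr.
have := convex_breg_ge0 cv d (x := w) (y := y) I I.
by rewrite breg_lincomb //; lra.
Qed.

End Translation.

Section Admissible.
Context {R : realType} {n : nat}.
Variables (h f g xi : 'rV[R]_n -> \bar R) (sigf sigmf gamma beta c : R).
Hypotheses (hfin : forall w, h w \is a fin_num) (ffin : forall w, f w \is a fin_num).
Hypotheses (C2h : twice_C (fine \o h)) (C2f : twice_C (fine \o f)).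
Hypothesis rc : relative_constants setT h f sigf sigmf.
Hypothesis gamma0 : 0 < gamma.
Local Notation hr := (fine \o h).
Local Notation fr := (fine \o f).
Local Notation hh := (fine \o hhat h f gamma).
Local Notation fh := (fine \o fhat h f gamma beta).

Definition descent_constant (cp : R) :=
  [/\ 0 < cp /\ cp <= c / (2 * gamma), forall w, xi w \is a fin_num,
      twice_C (fine \o xi), forall w y, 0 <= breg (fine \o xi) w y
    & forall w z y, 2 * cp * breg hr w z + breg (fine \o xi) w z
        <= model_gap hh fh w z y + breg (fine \o xi) z y].

Lemma alpha_pmf : gamma * Lfh sigf sigmf * (sigmf / Lfh sigf sigmf) = gamma * sigmf.
Proof. by field; rewrite gt_eqF // (Lfh_gt0 rc). Qed.

Lemma hh_fun : hh = lincomb gamma^-1 (-1) hr fr.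
Proof. by rewrite hhatE. Qed.

Lemma fh_fun : fh = lincomb 1 (- (beta / gamma)) fr hr.
Proof. by rewrite fhatE. Qed.

Lemma twice_C_hh : twice_C hh.
Proof. by rewrite hh_fun; exact: twice_C_lincomb. Qed.

Lemma twice_C_fh : twice_C fh.
Proof. by rewrite fh_fun; exact: twice_C_lincomb. Qed.

Lemma breg_hh w y : breg hh w y = gamma^-1 * breg hr w y - breg fr w y.
Proof. by rewrite hh_fun breg_lincomb // mulN1r. Qed.

Lemma breg_fh w y : breg fh w y = breg fr w y - beta / gamma * breg hr w y.
Proof. by rewrite fh_fun breg_lincomb // mul1r mulNr. Qed.

(** By the three-point identity the inertial term is D_fhat(w, y) - D_fhat(w, z)
   - D_fhat(z, y); the last term is cancelled by D_xi and the first one is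
   nonnegative. *)
Lemma descent_convex :
  admissible_convex setT h f sigf sigmf gamma beta c xi ->
  descent_constant (c / (2 * gamma)).
Proof.
case=> cvx _ xiE cE' c0.
have cE : c = 1 + 2 * beta + 3 * (gamma * sigmf) by rewrite cE' -alpha_pmf; ring.
rewrite /descent_constant xiE.
have fh0 w y : 0 <= breg fh w y.
  have [d _ _] := twice_C_lincomb 1 (- (beta / gamma)) C2f C2h.
  rewrite fh_fun; rewrite fh_fun in cvx.
  exact: (convex_breg_ge0 cvx d I I).
split.
- by split; [rewrite divr_gt0 // mulr_gt0|exact: lexx].
- by move=> w; rewrite fhatE.
- exact: twice_C_fh.
- exact: fh0.
move=> w z y; rewrite /model_gap three_point.
have := fh0 w y; have := relative_breg_le rc C2h C2f w z.
have -> : 2 * (c / (2 * gamma)) * breg hr w z = c / gamma * breg hr w z.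
  by congr (_ * _); field; rewrite gt_eqF.
have -> : c / gamma * breg hr w z = gamma^-1 * breg hr w z
   + 2 * (beta / gamma * breg hr w z) + 3 * (sigmf * breg hr w z).
  by rewrite cE; field; rewrite gt_eqF.
rewrite breg_hh (breg_fh w z).
move: (breg fh w y) (breg fh z y) (breg fr w z) (gamma^-1 * _) (beta / gamma * _) => *.
lra.
Qed.

(** Strong convexity turns the two squared norms produced by the Lipschitz
   estimate into Bregman distances; a modulus larger than 1 costs a factor. *)
Lemma descent_lipschitz :
  edom h = setT ->
  admissible_lipschitz setT h f sigf sigmf gamma beta c xi ->
  exists cp, descent_constant cp.
Proof.
move=> hT [L [sh [[L0 Lip] [sh0 str] xiE cE c0]]].
move: cE; rewrite alpha_pmf => cE.
have xir : fine \o xi = lincomb L 0 half_sq half_sq.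
  by rewrite xiE; apply/funext => w; rewrite /lincomb /half_sq /=; field.
have C2s := @twice_C_half_sq R n.
have bxi w y : breg (fine \o xi) w y = L / 2 * enorm (w - y) ^+ 2.
  by rewrite xir breg_lincomb // breg_half_sq mul0r addr0; field.
pose cp := Num.min (c / (2 * gamma)) (c / (2 * gamma * sh)).
have cp1 : cp <= c / (2 * gamma * sh) by rewrite ge_min lexx orbT.
exists cp; split.
- by split; [rewrite lt_min !divr_gt0 // !mulr_gt0|rewrite ge_min lexx].
- by move=> w; rewrite xiE.
- by rewrite xir; exact: twice_C_lincomb.
- by move=> w y; rewrite bxi mulr_ge0 ?sqr_ge0 // divr_ge0.
move=> w z y; rewrite !bxi /model_gap.
have hs : sh / 2 * enorm (w - z) ^+ 2 <= breg hr w z.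
  have C2l := twice_C_lincomb 1 (- sh) C2h C2s; have [d _ _] := C2l.
  have cv : convex_function setT (lincomb 1 (- sh) hr half_sq).
    have := str; rewrite hT; congr convex_function; apply/funext => v.
    by rewrite /lincomb /half_sq /=; field.
  have := convex_breg_ge0 cv d (x := w) (y := z) I I.
  by rewrite breg_lincomb // breg_half_sq; lra.
have D0 : 0 <= breg hr w z.
  by apply: le_trans hs; rewrite mulr_ge0 ?sqr_ge0 // divr_ge0 // ltW.
have rel := relative_breg_le rc C2h C2f w z.
have cs : - (enorm (w - z) * (L * enorm (z - y))) <= dot (w - z) (grad fh z - grad fh y).
  apply: le_trans (dot_ge _ _); rewrite lerN2 ler_wpM2l ?enorm_ge0 //.
  exact: Lip.
have amgm : enorm (w - z) * (L * enorm (z - y))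
    <= L / 2 * enorm (w - z) ^+ 2 + L / 2 * enorm (z - y) ^+ 2.
  rewrite -subr_ge0.
  have -> : L / 2 * enorm (w - z) ^+ 2 + L / 2 * enorm (z - y) ^+ 2 -
    enorm (w - z) * (L * enorm (z - y)) = L / 2 * (enorm (w - z) - enorm (z - y)) ^+ 2.
    by field.
  by rewrite mulr_ge0 ?sqr_ge0 // divr_ge0.
have key : 2 * cp * breg hr w z <= (gamma^-1 + sigmf - 2 * L / sh) * breg hr w z.
  rewrite ler_wpM2r //; apply: (@le_trans _ _ (2 * (c / (2 * gamma * sh)))).
    by rewrite ler_pM2l.
  rewrite cE le_eqVlt; apply/orP; left; apply/eqP.
  by field; rewrite !gt_eqF.
have big : L * enorm (w - z) ^+ 2 <= 2 * L / sh * breg hr w z.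
  have := ler_wpM2l (_ : 0 <= 2 * L / sh) hs; rewrite divr_ge0 ?mulr_ge0 ?(ltW sh0) //.
  move=> /(_ isT); apply: le_trans.
  by rewrite le_eqVlt; apply/orP; left; apply/eqP; field; rewrite gt_eqF.
rewrite breg_hh; move: cs amgm key big rel.
move: (dot _ _) (enorm (w - z) * _) (breg hr w z) (breg fr w z) => a b D e.
move: (enorm (w - z) ^+ 2) (enorm (z - y) ^+ 2) => u v cs amgm key big rel.
lra.
Qed.

End Admissible.

(** * The convergence theorem *)

Lemma frb_merit_descent (R : realType) (n : nat) (h f g xi : 'rV[R]_n -> \bar R)
    (sigf sigmf gamma beta c : R) (xm1 : 'rV[R]_n) (x : nat -> 'rV[R]_n) :
  legendre_kernel setT h ->
  standing_assumptions setT h f g ->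
  relative_constants setT h f sigf sigmf ->
  admissible setT h f sigf sigmf gamma beta c xi ->
  (forall k, frb_step h f g gamma beta (x k) (previous xm1 x k) (x k.+1)) ->
  level_bounded (cost f g) ->
  C2 f -> C2 h -> (forall y, posdef (hessian (fine \o h) y)) ->
  exists cp, (forall w, xi w \is a fin_num) /\
    merit_descent (cost f g) (fine \o hhat h f gamma) (fine \o fhat h f gamma beta)
      (fine \o h) (fine \o xi) (c / (2 * gamma)) cp x xm1.
Proof.
move=> lk sa rc [gamma0 adm] step lb /C2_twice C2f /C2_twice C2h pd.
have hfin := kernel_finite lk; have ffin := smooth_finite lk sa.
have [cp [[cp0 cpc] xif C2xi xi0 gap]] :
    exists cp, descent_constant h f xi gamma beta c cp.
  case: adm => adm.
    by exists (c / (2 * gamma)); exact: (descent_convex hfin ffin C2h C2f rc gamma0 adm).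
  apply: (descent_lipschitz hfin ffin C2h C2f rc gamma0 _ adm).
  by apply/seteqP; split => // w _; rewrite /edom /= ltey_eq hfin.
exists cp; split; first exact: xif.
split.
- exact: twice_C_hh.
- exact: twice_C_fh.
- exact: C2h.
- exact: C2xi.
- exact: pd.
- exact: cp0.
- exact: cpc.
- exact: (cost_proper lk sa).
- exact: (cost_lsc lk sa C2f).
- exact: lb.
- exact: (cost_bounded sa).
- exact: xi0.
- exact: gap.
- by move=> k w; have := step k w; rewrite !(modelE hfin ffin).
Qed.

Lemma lyapunovE (R : realType) (n : nat) (h f g xi : 'rV[R]_n -> \bar R)
    (gamma beta c : R) (y ym yp : 'rV[R]_n) :
  (forall w, h w \is a fin_num) -> (forall w, f w \is a fin_num) ->
  (forall w, xi w \is a fin_num) -> cost f g yp \is a fin_num ->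
  frb_step h f g gamma beta y ym yp ->
  lyapunov h f g gamma beta c xi y ym = (fine (cost f g yp)
    + merit_gap (fine \o hhat h f gamma) (fine \o fhat h f gamma beta)
        (fine \o h) (fine \o xi) (c / (2 * gamma)) yp y ym)%:E.
Proof.
move=> hfin ffin xif pfin step.
have env : envelope h f g gamma beta y ym = model h f g gamma beta yp y ym.
  apply: le_anti; apply/andP; split.
    by apply: ereal_inf_lbound; exists yp.
  by apply: le_ereal_inf_tmp => _ [w _ <-]; exact: step.
rewrite /lyapunov env (modelE hfin ffin) !bregmanE // -{1}(fineK pfin).
by rewrite -EFinM -!EFinD /merit_gap !addrA.
Qed.

Theorem theorem4p6 (R : realType) (n : nat) (h f g : 'rV[R]_n -> \bar R)
    (sigf sigmf gamma beta c : R) (xi : 'rV[R]_n -> \bar R)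
    (xm1 : 'rV[R]_n) (x : nat -> 'rV[R]_n) (r : R) (eta : \bar R)
    (L := fun k => lyapunov h f g gamma beta c xi (x k) (previous xm1 x k))
    (phistar := limn L)
    (F := merit h f g gamma beta c xi)
    (Omega := limit_points
                (fun k => triple (x k.+1) (x k) (previous xm1 x k)))
    (U := enlargement Omega r) :
  legendre_kernel setT h ->
  standing_assumptions setT h f g ->
  relative_constants setT h f sigf sigmf ->
  admissible setT h f sigf sigmf gamma beta c xi ->
  (forall k, frb_step h f g gamma beta (x k) (previous xm1 x k) (x k.+1)) ->
  level_bounded (cost f g) ->
  C2 f -> C2 h -> (forall y, posdef (hessian (fine \o h) y)) ->
  0 < r -> (0 < eta)%E ->
  setwise_KL F Omega U phistar eta ->
  [/\ cvgn (series (fun k => enorm (x k.+1 - x k))),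
      exists2 xstar : 'rV[R]_n,
        regular_subdiff (cost f g) xstar 0 & x k @[k --> \oo] --> xstar
    & exists (k0 : nat) (M : R) (a : 'rV[R]_n) (rho : R),
        [/\ 0 < M,
            forall k, eball a rho (x k),
            exists2 sigma : R,
              0 < sigma & strongly_convex_on (eball a rho) sigma h
          & forall sigma : R,
              0 < sigma -> strongly_convex_on (eball a rho) sigma h ->
              forall l : nat, (k0.+1 <= l)%N ->
                (0 <= L l - phistar < eta)%E /\
                limn (series (fun k => enorm (x k.+1 - x k)))
                <= \sum_(0 <= k < l.+1) enorm (x k.+1 - x k)
                   + 4 * gamma * M / (c * sigma)
                     * exact_modulus F U phistar eta (fine (L l - phistar))]].
Proof.
move=> lk sa rc adm step lb fC2 hC2 pd r0 eta0 KL.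
have [cp [xif md]] := frb_merit_descent lk sa rc adm step lb fC2 hC2 pd.
have hfin := kernel_finite lk; have ffin := smooth_finite lk sa.
have C2h := C2_twice hC2; have [gamma0 _] := adm.
have c0 : 0 < c.
  have := lt_le_trans (md_cp md) (md_c1 md).
  by rewrite pmulr_lgt0 // invr_gt0 mulr_gt0.
have LE k : L k = (lyap (cost f g) (fine \o hhat h f gamma) (fine \o fhat h f gamma beta)
    (fine \o h) (fine \o xi) x xm1 (c / (2 * gamma)) k)%:E.
  by apply: lyapunovE => //; rewrite (value_fin md).
have FE : F = real_merit (cost f g) (fine \o hhat h f gamma) (fine \o fhat h f gamma beta)
    (fine \o h) (fine \o xi) (c / (2 * gamma)) by exact: meritE.
have [rho [K [s [rho1 ib]]]] := iteration_boundsP md.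
have [s0 sm x_in prev_rho strong] := ib.
have x_rho k : enorm (x k) <= rho by apply: le_trans (x_in k) _; rewrite gerBl.
set mu := limit_value (cost f g) (fine \o hhat h f gamma) (fine \o fhat h f gamma beta)
  (fine \o h) (fine \o xi) cp x xm1.
have phiE : phistar = mu%:E.
  apply: cvg_lim => //; rewrite (funext LE).
  apply: cvg_EFin; first exact: nearW.
  exact: (lyap1_cvg md sm x_rho prev_rho s0 strong).
rewrite FE phiE in KL.
have fl := finite_length md sm x_rho prev_rho s0 strong r0 eta0 KL.
split => //.
  have [p xp [statp _]] := iterates_cvg md r0 eta0 ib KL.
  by exists p.
have exs : exists2 sigma : R, 0 < sigma & strongly_convex_on (eball 0 rho) sigma h.
  by exists s => //; exact: strongly_convex_ball.
have excE l : (L l - phistar = (lyap (cost f g) (fine \o hhat h f gamma)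
    (fine \o fhat h f gamma beta) (fine \o h) (fine \o xi) x xm1 (c / (2 * gamma)) l
    - mu)%:E)%E by rewrite LE phiE.
have exc0 := excess_ge0 md ib.
have [[d d1]|nod] := pselect (exists d : 'rV[R]_n, enorm d = 1); last first.
  (* n = 0: nothing bounds sigma, but every increment vanishes. *)
  have z0 (u : 'rV[R]_n) : enorm u = 0.
    have [//|u0] := eqVneq (enorm u) 0; exfalso; apply: nod.
    exists ((enorm u)^-1 *: u).
    by rewrite enormZ ger0_norm ?invr_ge0 ?enorm_ge0 // mulVf.
  have [k0 _ Hk0] := near_lt_eta eta0 (excess_cvg0 md ib).
  exists k0, 1, 0, rho; split; first exact: ltr01.
  - by move=> k; apply/eball0E.
  - exact: exs.
  move=> sigma sigma0 _ l kl; have le := Hk0 l (ltnW kl); rewrite excE /=.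
  split; first by rewrite lee_fin exc0.
  have [k|N|_ H] := @series_tail_bound _ (fun k => enorm (x k.+1 - x k)) 0 l.+1.
  - exact: enorm_ge0.
  - by rewrite big1 // => k _; exact: z0.
  apply: le_trans H _; rewrite lerD2l; apply: mulr_ge0.
    by rewrite divr_ge0 // ltW // !mulr_gt0.
  by rewrite FE phiE; exact: (modulus_excess_ge0 md ib KL).
have [k0 [C [C0 tail]]] := tail_bound md r0 eta0 ib KL d1.
have [S S0 HS] := strong_convexity_bounded h (lt_trans ltr01 rho1) d1.
(* sigma is at most S, which makes the constant independent of sigma. *)
exists k0, (C * c * S / (4 * gamma)), 0, rho; split.
- by rewrite divr_gt0 // !mulr_gt0.
- by move=> k; apply/eball0E.
- exact: exs.
move=> sigma sigma0 str l kl; rewrite excE /=; have [le tb] := tail l kl.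
split; first by rewrite lee_fin exc0.
apply: le_trans tb _; rewrite lerD2l -FE -phiE ler_wpM2r //.
  by rewrite FE phiE; exact: (modulus_excess_ge0 md ib KL).
have -> : 4 * gamma * (C * c * S / (4 * gamma)) / (c * sigma) = C * (S / sigma).
  by field; rewrite !gt_eqF.
by rewrite ler_peMr ?(ltW C0) // ler_pdivlMr // mul1r; exact: HS.
Qed.
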